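(* A generic solution $f$ of any of the equations (A), (B), (C), (D) listed in the context is nondegenerate on a small open set $U\subset\mathbb{R}^3$. If $f$ is such a solution (nondegenerate on $U$), then the corresponding 1-form $\alpha^\lambda$ defines a Veronese web $\{\mathcal{F}_\lambda\}$ on $U$ by $T\mathcal{F}_\lambda=\langle\alpha^\lambda\rangle^\perp$.
   Context: Equations on $f(x_1,x_2,x_3)$ (subscripts denote partial derivatives) and the associated 1-forms $\alpha^\lambda$ depending on the parameter $\lambda$: (A) $(\lambda_2-\lambda_3)f_{x_1}f_{x_2x_3}+(\lambda_3-\lambda_1)f_{x_2}f_{x_3x_1}+(\lambda_1-\lambda_2)f_{x_3}f_{x_1x_2}=0$, where $\lambda_i=\lambda_i(x_i)$; $\alpha^\lambda=(\lambda_2-\lambda)(\lambda_3-\lambda)f_{x_1}dx_1+(\lambda_3-\lambda)(\lambda_1-\lambda)f_{x_2}dx_2+(\lambda_1-\lambda)(\lambda_2-\lambda)f_{x_3}dx_3$. (B) $f_{x_1}f_{x_1x_3}-f_{x_3}f_{x_1x_1}+(\lambda_2(x_2)-\lambda_3(x_3))(f_{x_1}f_{x_2x_3}-f_{x_2}f_{x_1x_3})+\lambda_2'(x_2)f_{x_1}f_{x_3}=0$; $\alpha^\lambda=(\lambda_2-\lambda)(\lambda_3-\lambda)(f_{x_1}dx_1+f_{x_2}dx_2)+(\lambda_2-\lambda)^2f_{x_3}dx_3-(\lambda_3-\lambda)f_{x_1}dx_2$. (C) $f_{x_1}f_{x_1x_3}-f_{x_3}f_{x_1x_1}+e^{-\lambda_3'(x_3)x_2}(f_{x_2}f_{x_1x_2}-f_{x_1}f_{x_2x_2})+\lambda_3''(x_3)x_2f_{x_1}^2=0$;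 $\alpha^\lambda=(\lambda_3-\lambda)^2df-(\lambda_3-\lambda)(e^{\lambda_3'x_2}f_{x_1}dx_2+f_{x_2}dx_3)+e^{\lambda_3'x_2}f_{x_1}dx_3$. (D) $a(f_{x_1}f_{x_2x_3}-f_{x_2}f_{x_1x_3})+b(f_{x_3}f_{x_1x_1}+f_{x_3}f_{x_2x_2}-f_{x_1}f_{x_1x_3}-f_{x_2}f_{x_2x_3})+\lambda_3(x_3)(f_{x_2}f_{x_1x_3}-f_{x_1}f_{x_2x_3})=0$; $\alpha^\lambda=(\lambda_3-\lambda)\big((a-\lambda)(f_{x_1}dx_1+f_{x_2}dx_2)+b(f_{x_1}dx_2-f_{x_2}dx_1)\big)+((a-\lambda)^2+b^2)f_{x_3}dx_3$. Here the $\lambda_i(x_i)$ are smooth functions with $\lambda_i\neq\lambda_j$ for $i\neq j$, and in (D) $a=a(x_1,x_2)$, $b=b(x_1,x_2)\neq0$ are harmonic duals: $a_{x_1}=b_{x_2}$, $a_{x_2}=-b_{x_1}$. A solution $f$ on an open set $U$ is nondegenerate if, writing $\alpha^\lambda=\alpha_0+\lambda\alpha_1+\lambda^2\alpha_2$, the 1-forms $\alpha_0,\alpha_1,\alpha_2$ are linearly independent at every point of $U$. A generic solution means a solution with a generic jet in the Cauchy problem setup. A Veronese web on a 3-manifold is a collection $\{\mathcal{F}_\lambda\}_{\lambda\in\mathbb{R}\cup\{\infty\}}$ of codimension 1 foliations such that near every point there is a local coframe $(\alpha_0,\alpha_1,\alpha_2)$ with $(T\mathcal{F}_\lambda)^\perp=\langle\alpha_0+\lambda\alpha_1+\lambda^2\alpha_2\rangle$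 for all $\lambda$ (with $\langle\alpha_2\rangle$ for $\lambda=\infty$). *)

(* Defs.v *)
From HB Require Import structures.
From mathcomp Require Import all_boot all_order all_algebra.
From mathcomp Require Import all_classical all_reals all_analysis.

Set Implicit Arguments.
Unset Strict Implicit.
Unset Printing Implicit Defensive.

Import Order.TTheory GRing.Theory Num.Theory.
Import numFieldNormedType.Exports.

Local Open Scope classical_set_scope.
Local Open Scope ring_scope.

Section Calculus.
Variable R : realType.

Definition partial n (V : normedModType R) (i : 'I_n.+1)
    (f : 'rV[R]_n.+1 -> V) : 'rV[R]_n.+1 -> V :=
  fun x => 'D_(delta_mx 0 i) f x.

Fixpoint Cdiff n (k : nat) (U : set 'rV[R]_n.+1) (f : 'rV[R]_n.+1 -> R) : Prop :=
  match k with
  | 0 => forall x, U x -> {for x, continuous f}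
  | k'.+1 => (forall x, U x -> differentiable f x) /\
             (forall i, Cdiff k' U (partial i f))
  end.

(* C^oo on U; only used for open U, f being total but arbitrary off U. *)
Definition smooth n (U : set 'rV[R]_n.+1) (f : 'rV[R]_n.+1 -> R) : Prop :=
  forall k, Cdiff k U f.

Definition smooth1 (I : set R) (l : R -> R) : Prop :=
  forall k t, I t -> derivable (derive1n k l) t 1.

Definition smooth_row n m (U : set 'rV[R]_n.+1)
    (w : 'rV[R]_n.+1 -> 'rV[R]_m) : Prop :=
  forall j, smooth U (fun x => w x 0 j).

End Calculus.

Definition i1 : 'I_3 := @Ordinal 3 0 isT.
Definition i2 : 'I_3 := @Ordinal 3 1 isT.
Definition i3 : 'I_3 := @Ordinal 3 2 isT.
Definition j1 : 'I_2 := @Ordinal 2 0 isT.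
Definition j2 : 'I_2 := @Ordinal 2 1 isT.

Section Foliations.
Variable R : realType.

(* A covector at a point of R^3 is the row of its coefficients in dx1, dx2, dx3. *)
Definition pairing (w v : 'rV[R]_3) : R := \sum_(i < 3) w 0 i * v 0 i.

Definition form_ker (w : 'rV[R]_3) : set 'rV[R]_3 := [set v | pairing w v = 0].

Definition conormal (T : set 'rV[R]_3) : set 'rV[R]_3 :=
  [set w | forall v, T v -> pairing w v = 0].

Definition line (w : 'rV[R]_3) : set 'rV[R]_3 := range (fun c : R => c *: w).

(* A foliation F is represented by its tangent distribution T = TF, which
   determines it: T has to be integrable, that is, locally tangent to the
   level sets of a smooth submersion u, whose components are the plaques. *)
Definition codim1_foliation (U : set 'rV[R]_3)
    (T : 'rV[R]_3 -> set 'rV[R]_3) : Prop :=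
  forall p, U p -> exists (V : set 'rV[R]_3) (u : 'rV[R]_3 -> R),
    [/\ open V, V p, V `<=` U, smooth V u
      & forall x, V x ->
          (exists v, 'd u x v != 0) /\ T x = [set v | 'd u x v = 0]].

Definition coframe (U : set 'rV[R]_3) (a0 a1 a2 : 'rV[R]_3 -> 'rV[R]_3) : Prop :=
  [/\ smooth_row U a0, smooth_row U a1, smooth_row U a2
    & forall x, U x -> free [:: a0 x; a1 x; a2 x]].

(* The parameter space R u {oo} is option R, with None for oo. *)
Definition Veronese_web (U : set 'rV[R]_3)
    (TF : option R -> 'rV[R]_3 -> set 'rV[R]_3) : Prop :=
  (forall l, codim1_foliation U (TF l)) /\
  (forall p, U p -> exists (V : set 'rV[R]_3) (a0 a1 a2 : 'rV[R]_3 -> 'rV[R]_3),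
    [/\ open V, V p, V `<=` U, coframe V a0 a1 a2
      & forall x, V x ->
          (forall l : R, conormal (TF (Some l) x) =
             line (a0 x + l *: a1 x + l ^+ 2 *: a2 x)) /\
          conormal (TF None x) = line (a2 x)]).

End Foliations.

Section Equations.
Variable R : realType.

(* Parameters: lambda_1, lambda_2, lambda_3 for (A); lambda_2, lambda_3 for (B);
   lambda_3 for (C); a, b, lambda_3 for (D). *)
Inductive web_pde : Type :=
  | EqA of (R -> R) & (R -> R) & (R -> R)
  | EqB of (R -> R) & (R -> R)
  | EqC of (R -> R)
  | EqD of ('rV[R]_2 -> R) & ('rV[R]_2 -> R) & (R -> R).

Definition x12 (x : 'rV[R]_3) : 'rV[R]_2 := \row_(j < 2) x 0 (lift ord_max j).

Definition coord_image (i : 'I_3) (W : set 'rV[R]_3) : set R :=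
  (fun x : 'rV[R]_3 => x 0 i) @` W.

Definition admissible (W : set 'rV[R]_3) (E : web_pde) : Prop :=
  match E with
  | EqA l1 l2 l3 =>
    [/\ smooth1 (coord_image i1 W) l1, smooth1 (coord_image i2 W) l2,
        smooth1 (coord_image i3 W) l3
      & forall x, W x -> [/\ l1 (x 0 i1) <> l2 (x 0 i2),
          l2 (x 0 i2) <> l3 (x 0 i3) & l1 (x 0 i1) <> l3 (x 0 i3)]]
  | EqB l2 l3 =>
    [/\ smooth1 (coord_image i2 W) l2, smooth1 (coord_image i3 W) l3
      & forall x, W x -> l2 (x 0 i2) <> l3 (x 0 i3)]
  | EqC l3 => smooth1 (coord_image i3 W) l3
  | EqD a b l3 =>
    [/\ smooth (x12 @` W) a, smooth (x12 @` W) b, smooth1 (coord_image i3 W) l3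
      & forall y, (x12 @` W) y ->
        [/\ b y <> 0, partial j1 a y = partial j2 b y
          & partial j2 a y = - partial j1 b y]]
  end.

Definition pde_holds (E : web_pde) (f : 'rV[R]_3 -> R) (x : 'rV[R]_3) : Prop :=
  let f1 := partial i1 f x in
  let f2 := partial i2 f x in
  let f3 := partial i3 f x in
  let f11 := partial i1 (partial i1 f) x in
  let f22 := partial i2 (partial i2 f) x in
  let f12 := partial i2 (partial i1 f) x in
  let f13 := partial i3 (partial i1 f) x in
  let f23 := partial i3 (partial i2 f) x in
  let f31 := partial i1 (partial i3 f) x in
  match E with
  | EqA l1 l2 l3 =>
    let l1 := l1 (x 0 i1) in let l2 := l2 (x 0 i2) in let l3 := l3 (x 0 i3) in
    (l2 - l3) * f1 * f23 + (l3 - l1) * f2 * f31 + (l1 - l2) * f3 * f12 = 0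
  | EqB l2 l3 =>
    let dl2 := derive1 l2 (x 0 i2) in
    let l2 := l2 (x 0 i2) in let l3 := l3 (x 0 i3) in
    f1 * f13 - f3 * f11 + (l2 - l3) * (f1 * f23 - f2 * f13) + dl2 * f1 * f3 = 0
  | EqC l3 =>
    let dl3 := derive1 l3 (x 0 i3) in let ddl3 := derive1n 2 l3 (x 0 i3) in
    let x2 := x 0 i2 in
    f1 * f13 - f3 * f11 + expR (- (dl3 * x2)) * (f2 * f12 - f1 * f22)
      + ddl3 * x2 * f1 ^+ 2 = 0
  | EqD a b l3 =>
    let a := a (x12 x) in let b := b (x12 x) in let l3 := l3 (x 0 i3) in
    a * (f1 * f23 - f2 * f13)
      + b * (f3 * f11 + f3 * f22 - f1 * f13 - f2 * f23)
      + l3 * (f2 * f13 - f1 * f23) = 0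
  end.

Definition solution (U : set 'rV[R]_3) (E : web_pde) (f : 'rV[R]_3 -> R) : Prop :=
  smooth U f /\ forall x, U x -> pde_holds E f x.

(* The 1-form alpha^lambda at x, with the parameter lambda an indeterminate:
   a row of polynomials of degree at most 2 in lambda, so that alpha_coef E f k
   below, for k = 0, 1, 2, are the alpha_k of
   alpha^lambda = alpha_0 + lambda alpha_1 + lambda^2 alpha_2. *)
Definition alpha_pencil (E : web_pde) (f : 'rV[R]_3 -> R) (x : 'rV[R]_3) :
    'rV[{poly R}]_3 :=
  let lam : {poly R} := 'X in
  let dx1 : 'rV[{poly R}]_3 := delta_mx 0 i1 in
  let dx2 : 'rV[{poly R}]_3 := delta_mx 0 i2 in
  let dx3 : 'rV[{poly R}]_3 := delta_mx 0 i3 in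
  let f1 := (partial i1 f x)%:P in
  let f2 := (partial i2 f x)%:P in
  let f3 := (partial i3 f x)%:P in
  let df := f1 *: dx1 + f2 *: dx2 + f3 *: dx3 in
  match E with
  | EqA l1 l2 l3 =>
    let l1 := (l1 (x 0 i1))%:P in
    let l2 := (l2 (x 0 i2))%:P in
    let l3 := (l3 (x 0 i3))%:P in
    ((l2 - lam) * (l3 - lam) * f1) *: dx1
      + ((l3 - lam) * (l1 - lam) * f2) *: dx2
      + ((l1 - lam) * (l2 - lam) * f3) *: dx3
  | EqB l2 l3 =>
    let l2 := (l2 (x 0 i2))%:P in
    let l3 := (l3 (x 0 i3))%:P in
    ((l2 - lam) * (l3 - lam)) *: (f1 *: dx1 + f2 *: dx2)
      + ((l2 - lam) ^+ 2 * f3) *: dx3 - ((l3 - lam) * f1) *: dx2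
  | EqC l3 =>
    let e := (expR (derive1 l3 (x 0 i3) * x 0 i2))%:P in
    let l3 := (l3 (x 0 i3))%:P in
    (l3 - lam) ^+ 2 *: df - (l3 - lam) *: ((e * f1) *: dx2 + f2 *: dx3)
      + (e * f1) *: dx3
  | EqD a b l3 =>
    let a := (a (x12 x))%:P in
    let b := (b (x12 x))%:P in
    let l3 := (l3 (x 0 i3))%:P in
    (l3 - lam) *: ((a - lam) *: (f1 *: dx1 + f2 *: dx2)
                   + b *: (f1 *: dx2 - f2 *: dx1))
      + (((a - lam) ^+ 2 + b ^+ 2) * f3) *: dx3
  end.

Definition alpha (E : web_pde) (f : 'rV[R]_3 -> R) (l : R) (x : 'rV[R]_3) :
    'rV[R]_3 :=
  map_mx (fun q : {poly R} => q.[l]) (alpha_pencil E f x).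

Definition alpha_coef (E : web_pde) (f : 'rV[R]_3 -> R) (k : nat)
    (x : 'rV[R]_3) : 'rV[R]_3 :=
  map_mx (fun q : {poly R} => q`_k) (alpha_pencil E f x).

Definition nondegenerate_sol (U : set 'rV[R]_3) (E : web_pde)
    (f : 'rV[R]_3 -> R) : Prop :=
  forall x, U x ->
    free [:: alpha_coef E f 0 x; alpha_coef E f 1 x; alpha_coef E f 2 x].

Definition web_distribution (E : web_pde) (f : 'rV[R]_3 -> R) (l : option R)
    (x : 'rV[R]_3) : set 'rV[R]_3 :=
  match l with
  | Some l => form_ker (alpha E f l x)
  | None => form_ker (alpha_coef E f 2 x)
  end.

(* A (parametrized) surface s and a vector field nu along it and transverse
   to it, on which Cauchy data are prescribed. *)
Definition Cauchy_surface (Y : set 'rV[R]_2) (s nu : 'rV[R]_2 -> 'rV[R]_3) : Prop :=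
  [/\ open Y, smooth_row Y s, smooth_row Y nu
    & forall y, Y y -> free [:: partial j1 s y; partial j2 s y; nu y]].

(* The equations being of second order, Cauchy data are the functions f o s
   and (the derivative of f along nu) o s.  Their jet at y is taken at the
   order that corresponds to the 1-jet of f: 1 for the former, 0 for the latter. *)
Definition Cauchy_jet (s nu : 'rV[R]_2 -> 'rV[R]_3) (f : 'rV[R]_3 -> R)
    (y : 'rV[R]_2) : R * 'rV[R]_2 * R :=
  let phi := f \o s in
  let psi := fun z => 'D_(nu z) f (s z) in
  (phi y, \row_(j < 2) partial j phi y, psi y).

Definition generic_set (J : set (R * 'rV[R]_2 * R)) : Prop := open J /\ dense J.

End Equations.

(* Main.v *)
(** Integrability: for every lambda, [alpha^lambda /\ d alpha^lambda] is a multiple of the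
    left-hand side of the given equation, so that the kernel of [alpha^lambda] is tangent
    to a foliation by Frobenius' theorem.

    Frobenius' theorem for one smooth form [theta] with [theta_e = 1] is reduced to a
    scalar ODE with parameters.  Fix [p].  From [x], follow the curve
    [gamma(t) = p + t (x - p) + y(t) e] from [t = 1], [y(1) = 0], down to [t = 0], where [y]
    is chosen so that [theta(gamma') = 0].  Since [theta (d gamma / dx_i)] solves a
    linear homogeneous ODE (this is where integrability enters), the endpoint
    [u(x) = y(0)] satisfies [du = exp(J) theta].  The same computation expresses all first
    derivatives of [y(t, x)] as smooth functions of [y] and of the primitive [J] of
    a smooth function of [y], so that smoothness follows by bootstrapping.

    Genericity: the Cauchy data determine [df] linearly, and the determinant of
    [alpha_0, alpha_1, alpha_2] is a nonzero multiple of [f1 f2 f3], [f1^2 f3], [f1^3],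
    [(f1^2 + f2^2) f3] in the cases A, B, C, D. *)

Require Import Defs.
From mathcomp Require Import all_boot all_order all_algebra.
From mathcomp Require Import all_classical all_reals all_analysis.
From mathcomp Require Import ring lra.

Set Implicit Arguments.
Unset Strict Implicit.
Unset Printing Implicit Defensive.

Import Order.TTheory GRing.Theory Num.Theory.
Import numFieldNormedType.Exports.

Local Open Scope classical_set_scope.
Local Open Scope ring_scope.

(** * Differential calculus on row vectors *)

Section Derivatives.
Variable R : realType.

(** Going through a scalar ODE avoids flows of systems and the general theorem on their dependence
    on initial data. A contraction on a short interval gives the solution. Its derivative in the
    parameters is not found by an abstract argument: integrability supplies a closed formula, and a
    remainder estimate confirms it. Smoothness then only requires that primitives in time preserve
    C^k, which is differentiation under the integral sign.

    The multiplier of the equation in alpha /\ d alpha is a cubic in lambda: its roots are l1, l2,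
    l3 in case A; l2 twice and l3 in case B; l3 three times in case C, where an exponential factor
    appears as well; l3 and the complex pair a + ib, a - ib in case D. For lambda = oo the form is
    df, which is closed. Genericity uses one condition for all four equations, namely that no first
    derivative of f vanishes. *)

Lemma rV_sum_delta n (v : 'rV[R]_n) : v = \sum_j v 0 j *: delta_mx 0 j.
Proof. exact: row_sum_delta. Qed.

Lemma derive_rV n (g : 'rV[R]_n.+1 -> R) a v : differentiable g a ->
  'D_v g a = \sum_j v 0 j * partial j g a.
Proof.
move=> dg; rewrite deriveE// {1}(rV_sum_delta v) linear_sum/=.
by apply: eq_bigr => j _; rewrite linearZ/= /partial deriveE.
Qed.

Lemma differentiable_rV (V : normedModType R) n (phi : V -> 'rV[R]_n) a :
  (forall j, differentiable (fun x => phi x 0 j) a) -> differentiable phi a.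
Proof.
move=> dphi.
have -> : phi = \sum_(j < n) (fun x => phi x 0 j *: (delta_mx 0 j : 'rV[R]_n)).
  by apply/funext => x; rewrite {1}(rV_sum_delta (phi x)) fct_sumE.
by apply: differentiable_sum => j; exact: differentiableZl.
Qed.

Lemma continuous_rV (T : topologicalType) n (phi : T -> 'rV[R]_n) a :
  (forall j, {for a, continuous (fun x => phi x 0 j)}) -> {for a, continuous phi}.
Proof.
move=> cphi.
have -> : phi = (fun x => \sum_(j < n) phi x 0 j *: (delta_mx 0 j : 'rV[R]_n)).
  by apply/funext => x; rewrite {1}(rV_sum_delta (phi x)).
apply: cvg_big => [|j _]; first exact: add_continuous.
apply: cvgZr_tmp; exact: cphi.
Qed.

Lemma derive_comp_rV (V : normedModType R) n (phi : V -> 'rV[R]_n.+1)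
    (g : 'rV[R]_n.+1 -> R) a v :
  (forall j, differentiable (fun x => phi x 0 j) a) -> differentiable g (phi a) ->
  'D_v (g \o phi) a = \sum_j partial j g (phi a) * 'D_v (fun x => phi x 0 j) a.
Proof.
move=> dphi dg; have dp := differentiable_rV dphi.
rewrite deriveE; last exact: differentiable_comp.
rewrite diff_comp//= -!deriveE// derive_rV//.
apply: eq_bigr => j _; rewrite mulrC; congr (_ * _).
by rewrite derive_mx; [rewrite mxE|exact: diff_derivable].
Qed.

Lemma is_derive_line (V W : normedModType R) (g : V -> W) (a v : V) (t : R) :
  derivable g (t *: v + a) v ->
  is_derive t (1 : R) (fun s : R => g (s *: v + a)) ('D_v g (t *: v + a)).
Proof.
move=> dg; suff E : (fun h : R => h^-1 *: (((fun s : R => g (s *: v + a)) \o shift t) (h *: 1)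
      - g (t *: v + a))) =
    (fun h => h^-1 *: ((g \o shift (t *: v + a)) (h *: v) - g (t *: v + a))).
  by split; [rewrite /derivable E|rewrite /derive E].
by apply/funext => h /=; rewrite scalerDl [h *: 1]mulr1 addrA.
Qed.

(** The endpoints may come in either order, so that estimates for an ODE before and after its
    initial time are one argument. *)
Lemma MVT_between (f df : R -> R) (a b : R) :
  (forall t, Num.min a b <= t <= Num.max a b -> is_derive t (1 : R) f (df t)) ->
  exists2 c, Num.min a b <= c <= Num.max a b & f b - f a = df c * (b - a).
Proof.
wlog ab : a b / a <= b => [H|] hf.
  have /orP[ab|ba] := le_total a b; first exact: H.
  have [|c hc e] := H b a ba; first by move=> t; rewrite minC maxC; exact: hf.
  by exists c; [rewrite minC maxC|rewrite -opprB e -mulrN opprB].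
move: hf; rewrite (min_idPl ab) (max_idPr ab) => hf.
have [| |c hc e] := @MVT_segment R f df a b ab.
- by move=> t; rewrite in_itv/= => /andP[at_ tb]; apply: hf; rewrite !ltW.
- by apply: derivable_within_continuous => t; rewrite in_itv/= => /hf [].
- by exists c; rewrite // in_itv/= in hc.
Qed.

Lemma MVT_line n (f : 'rV[R]_n.+1 -> R) (a v : 'rV[R]_n.+1) (h : R) :
  (forall t, `|t| <= `|h| -> derivable f (t *: v + a) v) ->
  exists2 c, `|c| <= `|h| & f (h *: v + a) - f a = h * 'D_v f (c *: v + a).
Proof.
move=> df.
have bnd t : Num.min 0 h <= t <= Num.max 0 h -> `|t| <= `|h|.
  rewrite ge_min le_max => /andP[/orP h1 /orP h2].
  case: (ger0P h) => hh; rewrite ler_norml; apply/andP; split; lra.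
have [t /bnd th|c /bnd hc e] := @MVT_between (fun s => f (s *: v + a))
  (fun s => 'D_v f (s *: v + a)) 0 h.
  by apply: is_derive_line; exact: df.
by exists c => //; rewrite mulrC -[h in RHS]subr0 -e scale0r add0r.
Qed.

End Derivatives.

(** * Differentiability from continuous partial derivatives *)

Section ContinuousPartials.
Variable R : realType.

Lemma rV_norm_le n (v : 'rV[R]_n.+1) (M : R) :
  (forall j, `|v 0 j| <= M) -> `|v| <= M.
Proof.
move=> h; rewrite [`|v|]/Num.Def.normr/= mx_normrE; apply: bigmax_le.
  exact: le_trans (normr_ge0 _) (h 0).
by case=> i j _ /=; rewrite (ord1 i).
Qed.

Lemma rV_coord_le_norm n (v : 'rV[R]_n) j : `|v 0 j| <= `|v|.
Proof.
rewrite [`|v|]/Num.Def.normr/= mx_normrE.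
exact: (le_bigmax 0 (fun ij : 'I_1 * 'I_n => `|v ij.1 ij.2|) (0, j)).
Qed.

Lemma cvg_dist_lt (T : topologicalType) (g : T -> R) x (e : R) :
  {for x, continuous g} -> 0 < e -> \forall y \near x, `|g y - g x| < e.
Proof.
move=> cg e0; have /cvgrPdist_lt/(_ e e0) := cg.
by apply: filterS => y; rewrite distrC.
Qed.

Lemma continuous_of_dist_le (T : topologicalType) (g : T -> R) x :
  (forall e, 0 < e -> \forall y \near x, `|g y - g x| <= e) -> {for x, continuous g}.
Proof.
move=> H; apply/cvgrPdist_le => e /H; apply: filterS => y.
by rewrite distrC.
Qed.

Lemma near_between (T : topologicalType) (f : T -> R) z al be :
  {for z, continuous f} -> al < f z < be -> nbhs z [set y | al < f y < be].
Proof.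
move=> cf /andP[h1 h2].
have n1 : nbhs z [set y | al < f y] := cf _ (lt_nbhsr h1).
have n2 : nbhs z [set y | f y < be] := cf _ (lt_nbhsl h2).
by apply: filterS2 n1 n2 => y /= -> ->.
Qed.

Lemma open_norm_lt (T : topologicalType) (W : normedModType R) (f : T -> W) (dl : R) :
  continuous f -> open [set x | `|f x| < dl].
Proof.
move=> cf; rewrite openE => x hx.
have c1 : {for x, continuous (fun x => `|f x|)}.
  exact: (@continuous_comp _ _ _ f Num.norm x (cf x) (@norm_continuous _ _ _)).
have hx' : -1 < `|f x| < dl by rewrite hx andbT (lt_le_trans (ltrN10 R)).
by apply: filterS (near_between c1 hx') => y /andP[].
Qed.

Lemma near_all (T : topologicalType) (I : finType) (P : I -> set T) (x : T) :
  (forall i, nbhs x (P i)) -> nbhs x (fun y => forall i, P i y).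
Proof. by move=> h; apply: filter_forall. Qed.

Lemma near_normP n (x : 'rV[R]_n.+1) (P : set 'rV[R]_n.+1) :
  (\forall y \near x, P y) <-> exists2 d : R, 0 < d & forall y, `|y - x| < d -> P y.
Proof.
split=> [/nbhs_ballP[d /= d0 h]|[d d0 h]].
  exists d => // y hy; apply: h; rewrite -ball_normE/= distrC//.
apply/nbhs_ballP; exists d => //= y; rewrite -ball_normE/= distrC; exact: h.
Qed.

(** After subtraction of the linear candidate [L], the remainder has to be o(h). The increment is
    walked along the coordinate axes with one mean value per axis, and every intermediate point is
    at distance at most [|h|] from [x]. *)
Lemma differentiable_of_partials n (f : 'rV[R]_n.+1 -> R) x :
  (forall i, \forall y \near x, derivable f y (delta_mx 0 i)) ->
  (forall i, {for x, continuous (partial i f)}) -> differentiable f x.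
Proof.
move=> df cf.
pose L := \sum_(j < n.+1) (fun y : 'rV[R]_n.+1 => y 0 j *: partial j f x).
have dL y : differentiable L y.
  by apply: differentiable_sum => j; apply: differentiableZl; exact: differentiable_coord.
suff dfL : differentiable (f - L) x.
  by rewrite -(subrK L f); exact: differentiableD.
suff E : (f - L) \o shift x = cst ((f - L) x) + \0 +o_ 0 id.
  have dE : 'd (f - L) x = \0 :> ('rV[R]_n.+1 -> R).
    by apply: (@diff_unique _ _ _ _ \0 x) E; exact: cst_continuous.
  by apply/diff_locallyP; rewrite dE; split => //; exact: cst_continuous.
apply/eqaddoP => e e0.
have [d d0 hd] : exists2 d : R, 0 < d & forall y, `|y - x| < d -> forall i,
    derivable f y (delta_mx 0 i) /\ `|partial i f y - partial i f x| < e / n.+1%:R.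
  apply/near_normP; apply: near_all => i.
  have en0 : 0 < e / n.+1%:R by rewrite divr_gt0.
  by apply: filterS2 (df i) (cvg_dist_lt (cf i) en0).
apply/near_normP; exists d => // h; rewrite subr0 => hh.
have -> : ((f - L) \o shift x - (cst ((f - L) x) + \0)) h =
    f (h + x) - f x - \sum_j h 0 j * partial j f x.
  have LE y : L y = \sum_j y 0 j * partial j f x by rewrite /L fct_sumE.
  have LhD : L (h + x) = L h + L x.
    by rewrite !LE -big_split; apply: eq_bigr => i _; rewrite mxE mulrDl.
  rewrite -LE.
  transitivity (f (h + x) - L (h + x) - (f x - L x + 0)) => //.
  by rewrite LhD; ring.
(* [T k] keeps the first [k] coordinates of [h]; consecutive truncations differ along a single
   axis. *)
pose T k : 'rV[R]_n.+1 := \row_j (if (j < k)%N then h 0 j else 0).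
have TS (i : 'I_n.+1) : T i.+1 = h 0 i *: delta_mx 0 i + T i.
  apply/rowP => j; rewrite !mxE eqxx/= ltnS leq_eqVlt.
  case: (eqVneq j i) => [->|ji]; first by rewrite eqxx ltnn mulr1 addr0.
  by rewrite val_eqE (negPf ji) mulr0 add0r.
have -> : f (h + x) - f x = \sum_(i < n.+1) (f (T i.+1 + x) - f (T i + x)).
  rewrite -(big_mkord xpredT (fun i => f (T i.+1 + x) - f (T i + x))).
  rewrite (telescope_sumr (fun i => f (T i + x)))//; congr (f (_ + x) - f _).
    by apply/rowP => j; rewrite mxE ltn_ord.
  by rewrite (_ : T 0%N = 0) ?add0r//; apply/rowP => j; rewrite !mxE.
rewrite -sumrB.
have He : e * `|h| = \sum_(i < n.+1) (e / n.+1%:R * `|h|).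
  by rewrite sumr_const card_ord -mulrnAl -[_ / _ *+ _]mulr_natr divfK// pnatr_eq0.
rewrite He; apply: le_trans (ler_norm_sum _ _ _) _; apply: ler_sum => i _.
have near_pt c : `|c| <= `|h 0 i| -> `|c *: delta_mx 0 i + (T i + x) - x| < d.
  move=> hc; rewrite addrA addrK; apply: le_lt_trans hh; apply: rV_norm_le => j.
  rewrite !mxE eqxx/=; case: eqVneq => [->|_].
    by rewrite ltnn addr0 mulr1 (le_trans hc)// rV_coord_le_norm.
  by rewrite mulr0 add0r; case: ifP; rewrite ?rV_coord_le_norm ?normr0.
have [|c hc e1] := @MVT_line R n f (T i + x) (delta_mx 0 i) (h 0 i).
  by move=> t /near_pt/hd /(_ i) [].
rewrite TS -(addrA _ (T i) x) e1 -mulrBr normrM mulrC.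
have [_ /ltW h2] := hd _ (near_pt _ hc) i.
by apply: ler_pM => //; exact: rV_coord_le_norm.
Qed.

End ContinuousPartials.

(** * Closure properties of the classes C^k *)

Section CdiffClosure.
Variable R : realType.

Lemma CdiffS n k (U : set 'rV[R]_n.+1) f : Cdiff k.+1 U f -> Cdiff k U f.
Proof.
elim: k f => [|k IH] f /= [df pf].
  by move=> x Ux; apply: differentiable_continuous; exact: df.
by split=> // i; apply: IH; exact: pf.
Qed.

Lemma Cdiff_le n k l (U : set 'rV[R]_n.+1) f : (k <= l)%N -> Cdiff l U f -> Cdiff k U f.
Proof. by move=> /subnK <-; elim: (l - k)%N => // m IH /CdiffS. Qed.

Lemma Cdiff_continuous n k (U : set 'rV[R]_n.+1) f : Cdiff k U f ->
  forall x, U x -> {for x, continuous f}.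
Proof. by move=> h; exact: (Cdiff_le (leq0n k) h). Qed.

Lemma Cdiff_subset n k (U V : set 'rV[R]_n.+1) f : V `<=` U -> Cdiff k U f -> Cdiff k V f.
Proof.
move=> VU; elim: k f => [|k IH] f /=; first by move=> h x /VU; exact: h.
by move=> [df pf]; split=> [x /VU|i]; [exact: df|exact: IH].
Qed.

(** The total differentiability demanded at each level of [Cdiff] follows from continuous partial
    derivatives. This is the entry point for functions known only through their derivatives, such as
    solutions of an ODE. *)
Lemma CdiffS_of_partials n k (U : set 'rV[R]_n.+1) f : open U ->
  (forall i x, U x -> derivable f x (delta_mx 0 i)) ->
  (forall i, Cdiff k U (partial i f)) -> Cdiff k.+1 U f.
Proof.
move=> oU df pf; split=> // x Ux; apply: differentiable_of_partials => i.
  by apply: filterS (df i) _; exact: open_nbhs_nbhs.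
exact: Cdiff_continuous (pf i) _ Ux.
Qed.

Lemma open_near_eq (T : topologicalType) (W : Type) (U : set T) (f g : T -> W) x :
  open U -> (forall y, U y -> f y = g y) -> U x -> \forall y \near x, f y = g y.
Proof. by move=> oU fg Ux; apply: filterS fg _; exact: open_nbhs_nbhs. Qed.

Lemma near_eq_continuous (T V : topologicalType) (f g : T -> V) (x : T) :
  (\forall y \near x, f y = g y) -> {for x, continuous f} -> {for x, continuous g}.
Proof.
move=> fg cf; rewrite /prop_for/continuous_at -(nbhs_singleton fg).
by apply: cvg_trans cf; apply: near_eq_cvg.
Qed.

Lemma Cdiff_eq n k (U : set 'rV[R]_n.+1) f g : open U ->
  (forall x, U x -> f x = g x) -> Cdiff k U f -> Cdiff k U g.
Proof.
move=> oU; elim: k f g => [|k IH] f g fg /=.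
  by move=> cf x Ux; apply: near_eq_continuous (open_near_eq oU fg Ux) (cf x Ux).
move=> [df pf]; apply: CdiffS_of_partials => // i => [x Ux|].
  apply: near_eq_derivable (diff_derivable (df x Ux)).
  exact: (open_near_eq oU fg).
apply: IH (pf i) => x Ux; apply: near_eq_derive.
exact: (open_near_eq oU fg).
Qed.

Lemma Cdiff_cst n k (U : set 'rV[R]_n.+1) (c : R) : Cdiff k U (fun=> c).
Proof.
elim: k c => [|k IH] c /=; first by move=> x _; exact: cst_continuous.
split=> [x _|i]; first exact: differentiable_cst.
rewrite (_ : partial i _ = fun=> 0)//; apply/funext => x.
exact: derive_cst.
Qed.

Lemma Cdiff_coord n k (U : set 'rV[R]_n.+1) j : Cdiff k U (fun x => x 0 j).
Proof.
case: k => [|k]; first by move=> x _; exact: coord_continuous.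
split=> [x _|i]; first exact: differentiable_coord.
rewrite (_ : partial i _ = fun=> (delta_mx 0 i : 'rV[R]_n.+1) 0 j); first exact: Cdiff_cst.
apply/funext => x; have := @derive_mx R _ 1 n.+1 id x (delta_mx 0 i).
by rewrite derive_id => ->; [rewrite mxE|exact: derivable_id].
Qed.

Lemma CdiffD n k (U : set 'rV[R]_n.+1) f g : open U ->
  Cdiff k U f -> Cdiff k U g -> Cdiff k U (fun x => f x + g x).
Proof.
move=> oU; elim: k f g => [|k IH] f g.
  by move=> cf cg x Ux; exact: continuousD (cf x Ux) (cg x Ux).
move=> [df pf] [dg pg]; split=> [x Ux|i].
  by apply: (@differentiableD _ _ _ f g); [exact: df|exact: dg].
apply: Cdiff_eq (IH _ _ (pf i) (pg i)) => // x Ux.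
by rewrite /partial -deriveD//; apply: diff_derivable; [exact: df|exact: dg].
Qed.

Lemma CdiffM n k (U : set 'rV[R]_n.+1) f g : open U ->
  Cdiff k U f -> Cdiff k U g -> Cdiff k U (fun x => f x * g x).
Proof.
move=> oU; elim: k f g => [|k IH] f g.
  by move=> cf cg x Ux; exact: continuousM (cf x Ux) (cg x Ux).
move=> cf cg; have [df pf] := cf; have [dg pg] := cg; split=> [x Ux|i].
  by apply: (@differentiableM _ _ f g); [exact: df|exact: dg].
apply: Cdiff_eq (CdiffD oU (IH _ _ (CdiffS cf) (pg i)) (IH _ _ (CdiffS cg) (pf i))) => // x Ux.
by rewrite /partial -deriveM//; apply: diff_derivable; [exact: df|exact: dg].
Qed.

Lemma CdiffN n k (U : set 'rV[R]_n.+1) f : open U ->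
  Cdiff k U f -> Cdiff k U (fun x => - f x).
Proof.
move=> oU cf; apply: Cdiff_eq (CdiffM oU (Cdiff_cst k U (-1)) cf) => // x _.
by rewrite mulN1r.
Qed.

Lemma CdiffB n k (U : set 'rV[R]_n.+1) f g : open U ->
  Cdiff k U f -> Cdiff k U g -> Cdiff k U (fun x => f x - g x).
Proof. by move=> oU cf cg; apply: CdiffD => //; exact: CdiffN. Qed.

Lemma Cdiff_sum n k (U : set 'rV[R]_n.+1) m (f : 'I_m -> 'rV[R]_n.+1 -> R) : open U ->
  (forall j, Cdiff k U (f j)) -> Cdiff k U (fun x => \sum_j f j x).
Proof.
move=> oU; elim: m f => [|m IH] f cf.
  by apply: Cdiff_eq (Cdiff_cst k U 0) => // x _; rewrite big_ord0.
apply: Cdiff_eq (CdiffD oU (IH (fun j => f (widen_ord (leqnSn m) j)) _) (cf ord_max)) => //.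
by move=> x _; rewrite big_ord_recr.
Qed.

Lemma Cdiff_comp n m k (U : set 'rV[R]_n.+1) (V : set 'rV[R]_m.+1)
    (phi : 'rV[R]_n.+1 -> 'rV[R]_m.+1) g : open U ->
  (forall x, U x -> V (phi x)) -> (forall j, Cdiff k U (fun x => phi x 0 j)) ->
  Cdiff k V g -> Cdiff k U (fun x => g (phi x)).
Proof.
move=> oU UV; elim: k g => [|k IH] g cphi cg.
  move=> x Ux; apply: (@continuous_comp _ _ _ phi g); last exact/cg/UV.
  by apply: continuous_rV => j; exact: cphi.
have dphi x j : U x -> differentiable (fun x => phi x 0 j) x.
  by move=> Ux; case: (cphi j) => + _; exact.
case: (cg) => dg pg; split=> [x Ux|i].
  apply: (@differentiable_comp _ _ _ _ phi g); last exact/dg/UV.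
  by apply: differentiable_rV => j; exact: dphi.
apply: Cdiff_eq (_ : Cdiff k U (fun x => \sum_j partial j g (phi x) *
  partial i (fun x => phi x 0 j) x)) => //.
  move=> x Ux; rewrite /partial -derive_comp_rV//; last exact/dg/UV.
  by move=> j; exact: dphi.
apply: Cdiff_sum => // j; apply: CdiffM => //; last by case: (cphi j) => _; exact.
by apply: IH => [l|]; [exact: CdiffS|exact: pg].
Qed.

Lemma smooth1_comp_Cdiff n k (U : set 'rV[R]_n.+1) (I : set R) (l : R -> R) g : open U ->
  smooth1 I l -> (forall x, U x -> I (g x)) -> Cdiff k U g -> Cdiff k U (fun x => l (g x)).
Proof.
move=> oU; elim: k l => [|k IH] l sl UI cg.
  move=> x Ux; apply: (@continuous_comp _ _ _ g l); first exact: cg.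
  apply: differentiable_continuous; apply/derivable1_diffP.
  exact: (sl 0%N _ (UI _ Ux)).
case: (cg) => dg pg.
have dl x : U x -> differentiable l (g x).
  by move=> Ux; apply/derivable1_diffP; exact: (sl 0%N _ (UI _ Ux)).
split=> [x Ux|i].
  by apply: (@differentiable_comp _ _ _ _ g l); [exact: dg|exact: dl].
apply: Cdiff_eq (CdiffM oU (IH (derive1 l) _ UI (CdiffS cg)) (pg i)) => //.
  move=> x Ux; have dgx := dg x Ux; have dlx := dl x Ux.
  have dlg : differentiable (l \o g) x by exact: differentiable_comp.
  rewrite /partial (deriveE _ dgx) (deriveE _ dlg) (diff_comp dgx dlx)/= (diff1E dlx).
  by rewrite mulrC.
by move=> j t It; have := sl j.+1 t It; rewrite derive1Sn.
Qed.

Lemma CdiffV n k (U : set 'rV[R]_n.+1) f : open U -> (forall x, U x -> f x != 0) ->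
  Cdiff k U f -> Cdiff k U (fun x => (f x)^-1).
Proof.
move=> oU f0; elim: k f f0 => [|k IH] f f0 cf.
  by move=> x Ux; exact: continuousV (f0 x Ux) (cf x Ux).
case: (cf) => df pf; split=> [x Ux|i].
  by apply: differentiableV; [exact: df|exact: f0].
have IHf := IH f f0 (CdiffS cf).
apply: Cdiff_eq (CdiffM oU (CdiffN oU (CdiffM oU IHf IHf)) (pf i)) => // x Ux.
rewrite /partial deriveV; [|exact: f0|exact/diff_derivable/df].
by rewrite expr2 invfM.
Qed.

Lemma Cdiff_expR n k (U : set 'rV[R]_n.+1) f : open U ->
  Cdiff k U f -> Cdiff k U (fun x => expR (f x)).
Proof.
move=> oU; apply: (@smooth1_comp_Cdiff n k U setT expR) => //.
have E j : derive1n j (@expR R) = expR.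
  elim: j => // j; rewrite derive1nS => ->.
  by apply/funext => x; rewrite derive1E derive_val.
by move=> j t _; rewrite E; exact: derivable_expR.
Qed.

End CdiffClosure.

(** * Second-order expansions and symmetry of second derivatives *)

Section Taylor.
Variable R : realType.

Lemma MVT_ball n (f : 'rV[R]_n.+1 -> R) (p a b : 'rV[R]_n.+1) (d : R) :
  (forall y, `|y - p| < d -> differentiable f y) -> `|a - p| < d -> `|b - p| < d ->
  exists xi, [/\ `|xi - p| < d, `|xi - a| <= `|b - a|
    & f b - f a = \sum_j (b - a) 0 j * partial j f xi].
Proof.
move=> df ap bp.
have seg (t : R) : 0 <= t <= 1 -> `|t *: (b - a) + a - p| < d.
  move=> /andP[t0 t1].
  have -> : t *: (b - a) + a - p = t *: (b - p) + (1 - t) *: (a - p).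
    by apply/rowP => j; rewrite !mxE; ring.
  apply: le_lt_trans (ler_normD _ _) _; rewrite !normrZ (ger0_norm t0).
  rewrite (@ger0_norm _ (1 - t)) ?subr_ge0//.
  have [->|tn0] := eqVneq t 0; first by rewrite subr0 mul0r add0r mul1r.
  have tgt : 0 < t by rewrite lt_neqAle eq_sym tn0.
  have -> : d = t * d + (1 - t) * d by ring.
  by apply: ltr_leD; rewrite ?ltr_pM2l// ler_wpM2l ?subr_ge0// ltW.
have minmax (t : R) : Num.min 0 1 <= t <= Num.max 0 1 -> 0 <= t <= 1.
  by rewrite (min_idPl ler01) (max_idPr ler01).
have [t /minmax th|c /minmax hc e] := @MVT_between R (fun s => f (s *: (b - a) + a))
    (fun s => 'D_(b - a) f (s *: (b - a) + a)) 0 1.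
  by apply: is_derive_line; apply: diff_derivable; apply: df; exact: seg.
exists (c *: (b - a) + a); split; first exact: seg.
  rewrite addrK normrZ; case/andP: hc => c0 c1.
  by rewrite (ger0_norm c0) ler_piMl.
rewrite -derive_rV; last by apply: df; exact: seg.
by move: e; rewrite scale1r scale0r add0r subrK subr0 mulr1.
Qed.

(** By continuity, values and first partials on a small ball are at most their absolute values at
    [p] plus 1, and [M] dominates all these bounds. Mean values on the convex ball then give a
    constant common to the whole finite family. *)
Lemma lipschitz_near (I : finType) n (f : I -> 'rV[R]_n.+1 -> R) (U : set 'rV[R]_n.+1) p :
  open U -> U p -> (forall j, Cdiff 1 U (f j)) ->
  exists d C : R, [/\ 0 < d, 0 <= C, (forall a, `|a - p| < d -> U a),
    (forall j a, `|a - p| < d -> `|f j a| <= C) &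
    forall j a b, `|a - p| < d -> `|b - p| < d -> `|f j b - f j a| <= C * `|b - a|].
Proof.
move=> oU Up cf.
pose M := \sum_j (`|f j p| + 1 + \sum_(i < n.+1) (`|partial i (f j) p| + 1)).
have pos1 j : 0 <= \sum_(i < n.+1) (`|partial i (f j) p| + 1).
  by apply: sumr_ge0 => i _; rewrite addr_ge0.
have pos2 j : 0 <= `|f j p| + 1 + \sum_(i < n.+1) (`|partial i (f j) p| + 1).
  by rewrite !addr_ge0.
have M0 : 0 <= M by apply: sumr_ge0 => j _.
have leM j : `|f j p| + 1 + \sum_(i < n.+1) (`|partial i (f j) p| + 1) <= M.
  by rewrite /M (bigD1 j)//= lerDl; apply: sumr_ge0 => ? _.
have bnd (g : 'rV[R]_n.+1 -> R) : {for p, continuous g} ->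
    \forall y \near p, `|g y| <= `|g p| + 1.
  move=> cg; apply: filterS (cvg_dist_lt cg ltr01) => y /ltW h.
  by rewrite -(subrK (g p) (g y)) addrC (le_trans (ler_normD _ _))// lerD2l.
have [d d0 hd] : exists2 d : R, 0 < d & forall y, `|y - p| < d ->
    U y /\ forall j, `|f j y| <= `|f j p| + 1 /\
      forall i, `|partial i (f j) y| <= `|partial i (f j) p| + 1.
  apply/near_normP; apply: filterI; first exact: open_nbhs_nbhs.
  apply: near_all => j; apply: filterI.
    by apply: bnd; exact: (Cdiff_continuous (cf j) Up).
  apply: near_all => i; apply: bnd.
  by case: (cf j) => _ /(_ i); exact.
exists d, ((n.+1)%:R * M + M); split=> //.
- by rewrite addr_ge0// mulr_ge0.
- by move=> a /hd[].
- move=> j a /hd[_ /(_ j)[h _]]; apply: le_trans h _.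
  apply: (@le_trans _ _ M); last by rewrite lerDr mulr_ge0.
  by apply: le_trans (leM j); rewrite lerDl.
move=> j a b ap bp.
have [|xi [/hd[_ /(_ j)[_ hxi]] _ ->]] := @MVT_ball n (f j) p a b d _ ap bp.
  by move=> y /hd[Uy _]; case: (cf j) => + _; exact.
apply: (@le_trans _ _ (n.+1%:R * M * `|b - a|)); last first.
  by apply: ler_wpM2r => //; rewrite lerDl.
have -> : n.+1%:R * M * `|b - a| = \sum_(i < n.+1) (M * `|b - a|).
  by rewrite sumr_const card_ord -mulrA mulr_natl.
apply: le_trans (ler_norm_sum _ _ _) _; apply: ler_sum => i _.
rewrite normrM mulrC; apply: ler_pM => //; last exact: rV_coord_le_norm.
apply: le_trans (hxi i) (le_trans _ (leM j)).
rewrite (bigD1 i)//= addrCA lerDl addr_ge0//.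
by apply: sumr_ge0 => i' _; rewrite addr_ge0.
Qed.

(** [lipschitz_near] is applied to the functions and their first partials at once; a Lipschitz
    gradient turns the mean value formula into a quadratic remainder. *)
Lemma taylor2_near (I : finType) n (f : I -> 'rV[R]_n.+1 -> R) (U : set 'rV[R]_n.+1) p :
  open U -> U p -> (forall j, Cdiff 2 U (f j)) ->
  exists d C : R, [/\ 0 < d, 0 <= C, (forall a, `|a - p| < d -> U a),
    (forall j a, `|a - p| < d -> `|f j a| <= C /\ forall i, `|partial i (f j) a| <= C) &
    forall j a b, `|a - p| < d -> `|b - p| < d -> `|f j b - f j a| <= C * `|b - a| /\
      `|f j b - f j a - \sum_i (b - a) 0 i * partial i (f j) a| <= C * `|b - a| ^+ 2].
Proof.
move=> oU Up cf.
pose g (s : I + I * 'I_n.+1) := match s with inl j => f j | inr (j, i) => partial i (f j) end.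
have [|d [C [d0 C0 dU gC gL]]] := @lipschitz_near _ n g U p oU Up.
  case=> [j|[j i]]; first exact: (CdiffS (cf j)).
  by case: (cf j) => _ /(_ i).
exists d, (n.+1%:R * C + C); split=> //.
- by rewrite addr_ge0// mulr_ge0.
- move=> j a ap; split=> [|i].
    by apply: le_trans (gC (inl j) a ap) _; rewrite lerDr mulr_ge0.
  by apply: le_trans (gC (inr (j, i)) a ap) _; rewrite lerDr mulr_ge0.
move=> j a b ap bp; split.
  apply: le_trans (gL (inl j) a b ap bp) _.
  by apply: ler_wpM2r => //; rewrite lerDr mulr_ge0.
have [|xi [xip xia ->]] := @MVT_ball n (f j) p a b d _ ap bp.
  by move=> y /dU Uy; case: (cf j) => + _; exact.
rewrite -sumrB.
apply: (@le_trans _ _ (n.+1%:R * C * `|b - a| ^+ 2)); last first.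
  by apply: ler_wpM2r; rewrite ?exprn_ge0// lerDl.
have -> : n.+1%:R * C * `|b - a| ^+ 2 = \sum_(i < n.+1) (`|b - a| * (C * `|b - a|)).
  by rewrite sumr_const card_ord -[RHS]mulr_natl; ring.
apply: le_trans (ler_norm_sum _ _ _) _; apply: ler_sum => i _.
rewrite -mulrBr normrM; apply: ler_pM => //; first exact: rV_coord_le_norm.
apply: le_trans (gL (inr (j, i)) a xi ap xip) _.
exact: ler_wpM2l.
Qed.

Lemma le0_of_le_small (D K d : R) : 0 < d -> 0 <= K ->
  (forall h, 0 < h < d -> D <= K * h) -> D <= 0.
Proof.
move=> d0 K0 H; rewrite leNgt; apply/negP => D0.
have K1 : 0 < K + 1 by lra.
pose h := Num.min (d / 2) (D / 2 / (K + 1)).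
have h0 : 0 < h by rewrite lt_min !divr_gt0.
have hd : h < d by rewrite gt_min; apply/orP; left; lra.
have := H h; rewrite h0 hd => /(_ isT).
have : (K + 1) * h <= D / 2.
  by rewrite mulrC -ler_pdivlMr// ge_min lexx orbT.
by rewrite mulrDl mul1r; lra.
Qed.

Lemma sum_delta2 n (i j : 'I_n.+1) (c s : R) (G : 'I_n.+1 -> R) :
  \sum_k (c *: delta_mx 0 i + s *: delta_mx 0 j : 'rV[R]_n.+1) 0 k * G k = c * G i + s * G j.
Proof.
rewrite (eq_bigr (fun k => (if k == i then c * G k else 0) + (if k == j then s * G k else 0))).
  by rewrite big_split/= -!big_mkcond/= !big_pred1_eq.
move=> k _; rewrite !mxE !eqxx/= mulrDl.
by case: (k == i); case: (k == j); rewrite ?mulr1 ?mulr0 ?mul0r.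
Qed.

Lemma second_difference n (f : 'rV[R]_n.+1 -> R) (U : set 'rV[R]_n.+1) x i j :
  open U -> U x -> Cdiff 3 U f -> i != j ->
  exists d C : R, [/\ 0 < d, 0 <= C & forall h, 0 < h < d ->
    `|f (h *: delta_mx 0 i + h *: delta_mx 0 j + x) - f (h *: delta_mx 0 i + x)
      - (f (h *: delta_mx 0 j + x) - f x) - h ^+ 2 * partial j (partial i f) x| <= C * h ^+ 3].
Proof.
move=> oU Ux cf ij; case: (cf) => df /(_ i) cA.
have [d [C [d0 C0 dU _ hT]]] := @taylor2_near unit n (fun _ => partial i f) U x oU Ux (fun=> cA).
have {}hT := hT tt x; exists d, (C + C); split=> //; first by rewrite addr_ge0.
move=> h /andP[h0 hd]; set ei := delta_mx 0 i; set ej := delta_mx 0 j.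
set A := partial i f in cA hT *.
have nrm (c s : R) : 0 <= c <= h -> 0 <= s <= h -> `|c *: ei + s *: ej| <= h.
  move=> /andP[c0 c1] /andP[s0 s1]; apply: rV_norm_le => k; rewrite !mxE !eqxx/=.
  have [->|ki] := eqVneq k i.
    by rewrite (negPf ij) mulr1 mulr0 addr0 ger0_norm.
  by case: (k == j); rewrite mulr0 add0r ?mulr1 ?mulr0 ?normr0 ?ger0_norm// ltW.
have pt (c s : R) : 0 <= c <= h -> 0 <= s <= h -> `|c *: ei + s *: ej + x - x| < d.
  by move=> hc hs; rewrite addrK; apply: le_lt_trans hd; exact: nrm.
have hh : 0 <= h <= h by rewrite lexx ltW.
have h00 : 0 <= (0 : R) <= h by rewrite lexx ltW.
pose phi t := f (t *: ei + (h *: ej + x)) - f (t *: ei + (0 *: ej + x)).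
have minmax (t : R) : Num.min 0 h <= t <= Num.max 0 h -> 0 <= t <= h.
  by rewrite (min_idPl (ltW h0)) (max_idPr (ltW h0)).
have [t /minmax ht|c /minmax hc] := @MVT_between R phi
    (fun t => A (t *: ei + (h *: ej + x)) - A (t *: ei + (0 *: ej + x))) 0 h.
  apply: is_deriveB; apply: is_derive_line; apply: diff_derivable; apply: df; apply: dU;
    rewrite addrA; exact: pt.
rewrite /phi !scale0r !add0r subr0 addrA => ->.
have expand (s : R) : 0 <= s <= h ->
    `|A (c *: ei + s *: ej + x) - A x - (c * partial i A x + s * partial j A x)| <= C * h ^+ 2.
  move=> hs.
  have [|_] := hT (c *: ei + s *: ej + x) _ (pt _ _ hc hs); first by rewrite subrr normr0.
  have -> : c *: ei + s *: ej + x - x = c *: ei + s *: ej by rewrite addrK.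
  rewrite sum_delta2.
  move=> H; apply: le_trans H _; apply: ler_wpM2l => //.
  by rewrite lerXn2r ?nnegrE ?normr_ge0 ?(ltW h0)//; exact: nrm.
have e1 := expand h hh; have := expand 0 h00.
rewrite scale0r mul0r !addr0 => e0.
have alg (a1 a2 a0 u v : R) : (a1 - a2) * h - h ^+ 2 * v =
  h * ((a1 - a0 - (c * u + h * v)) - (a2 - a0 - c * u)) by ring.
rewrite (alg _ _ (A x) (partial i A x)).
rewrite normrM (gtr0_norm h0).
have -> : (C + C) * h ^+ 3 = h * (C * h ^+ 2 + C * h ^+ 2) by ring.
rewrite ler_pM2l//; apply: le_trans (ler_normB _ _) _.
by apply: lerD => //; rewrite addrA.
Qed.

(* The second difference is symmetric in [i] and [j]. *)
Lemma partial_comm n (f : 'rV[R]_n.+1 -> R) (U : set 'rV[R]_n.+1) x i j :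
  open U -> U x -> Cdiff 3 U f ->
  partial j (partial i f) x = partial i (partial j f) x.
Proof.
move=> oU Ux cf; have [->//|ij] := eqVneq i j.
have [d [C [d0 C0 H]]] := second_difference oU Ux cf ij.
have ji : j != i by rewrite eq_sym.
have [d' [C' [d'0 C'0 H']]] := second_difference oU Ux cf ji.
apply/eqP; rewrite -subr_eq0 -normr_le0.
apply: (@le0_of_le_small _ (C + C') (Num.min d d')); rewrite ?lt_min ?d0 ?addr_ge0//.
move=> h /andP[h0]; rewrite lt_min => /andP[hd hd'].
have := H h; rewrite h0 hd => /(_ isT) {}H.
have := H' h; rewrite h0 hd' => /(_ isT) {}H'.
have h20 : 0 < h ^+ 2 by rewrite exprn_gt0.
rewrite -(ler_pM2l h20) -{1}(gtr0_norm h20) -normrM.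
move: H H'; rewrite [h *: delta_mx 0 j + h *: delta_mx 0 i]addrC.
set a := f _; set b := f _; set c := f _; set e := f _.
set P := partial j _ x; set Q := partial i _ x => H H'.
have -> : h ^+ 2 * (P - Q) = (a - c - (b - e) - h ^+ 2 * Q) - (a - b - (c - e) - h ^+ 2 * P).
  by move: a b c e P Q {H H'} => a b c e P Q; ring.
apply: le_trans (ler_normB _ _) _.
have -> : h ^+ 2 * ((C + C') * h) = C' * h ^+ 3 + C * h ^+ 3 by ring.
exact: lerD.
Qed.

End Taylor.

(** * Scalar ordinary differential equations *)

Section ScalarODE.
Variable R : realType.
Implicit Types (a b c t : R).

Lemma between_itv a b c t s : a < c < b -> a < t < b ->
  Num.min c t <= s <= Num.max c t -> a < s < b.
Proof.
move=> /andP[ac cb] /andP[at_ tb] /andP[h1 h2]; apply/andP; split.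
  by apply: lt_le_trans h1; rewrite lt_min ac.
by apply: le_lt_trans h2 _; rewrite gt_max cb.
Qed.

Lemma dist_itv a b c t : a < c < b -> a < t < b -> `|t - c| <= b - a.
Proof.
move=> /andP[h1 h2] /andP[h3 h4].
by rewrite ler_norml; apply/andP; split; lra.
Qed.

Lemma is_derive1_continuous (f : R -> R) (df t : R) :
  is_derive t (1 : R) f df -> {for t, continuous f}.
Proof.
by move=> [dft _]; apply: differentiable_continuous; exact/derivable1_diffP.
Qed.

Lemma is_derive_unique_on (f g df : R -> R) a b c : a < c < b -> f c = g c ->
  (forall t, a < t < b -> is_derive t (1 : R) f (df t)) ->
  (forall t, a < t < b -> is_derive t (1 : R) g (df t)) ->
  forall t, a < t < b -> f t = g t.
Proof.
move=> hc fgc hf hg t ht.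
have [s hs|x hx] := @MVT_between R (fun s => f s - g s) (fun=> 0) c t.
  have h := between_itv hc ht hs; rewrite -(subrr (df s)).
  by apply: is_deriveB; [exact: hf|exact: hg].
by rewrite mul0r fgc subrr subr0 => /eqP; rewrite subr_eq0 => /eqP.
Qed.

Lemma primitive_on_closed (h : R -> R) a b : a < b ->
  (forall t, a <= t <= b -> {for t, continuous h}) ->
  exists H : R -> R, forall t, a < t < b -> is_derive t (1 : R) H (h t).
Proof.
move=> ab ch; exists (fun x => \int[lebesgue_measure]_(t in `[a, x]) h t)%R => t /andP[at_ tb].
have int : lebesgue_measure.-integrable `[a, b] (EFin \o h).
  apply: continuous_compact_integrable; first exact: segment_compact.
  apply: continuous_in_subspaceT => x; rewrite inE/= in_itv/= => hx; exact: ch.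
have [|d e] := continuous_FTC1_closed tb int at_; first by apply: ch; rewrite !ltW.
by split; [exact: d|rewrite -derive1E].
Qed.

(* Primitives on compact subintervals agree where both are defined, hence glue. *)
Lemma primitive_on_open (h : R -> R) a b c : a < c < b ->
  (forall t, a < t < b -> {for t, continuous h}) ->
  exists H : R -> R, H c = 0 /\ forall t, a < t < b -> is_derive t (1 : R) H (h t).
Proof.
move=> /andP[ac cb] ch.
have exP (p : R * R) : exists H : R -> R, a < p.1 < c /\ c < p.2 < b ->
    H c = 0 /\ forall t, p.1 < t < p.2 -> is_derive t (1 : R) H (h t).
  case: (pselect (a < p.1 < c /\ c < p.2 < b)) => [[/andP[h1 h2] /andP[h3 h4]]|np]; last first.
    by exists (fun=> 0) => /np.
  have [|t /andP[t1 t2]|H dH] := @primitive_on_closed h p.1 p.2.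
  - exact: lt_trans h2 h3.
  - by apply: ch; rewrite (lt_le_trans h1 t1) (le_lt_trans t2 h4).
  exists (fun t => H t - H c) => _; split=> [|t ht]; first by rewrite subrr.
  rewrite -(subr0 (h t)); apply: is_deriveB; first exact: dH.
have [P hP] := choice exP.
pose al t := (a + Num.min c t) / 2; pose be t := (b + Num.max c t) / 2.
have hal t : a < t < b -> a < al t < Num.min c t.
  move=> /andP[h1 h2]; rewrite /al; have : a < Num.min c t by rewrite lt_min ac.
  move: (Num.min c t) => m; lra.
have hbe t : a < t < b -> Num.max c t < be t < b.
  move=> /andP[h1 h2]; rewrite /be; have : Num.max c t < b by rewrite gt_max cb.
  move: (Num.max c t) => m; lra.
have adm t : a < t < b -> [/\ a < al t < c, c < be t < b & al t < t < be t].
  move=> ht; have /andP[h1] := hal t ht; have /andP[] := hbe t ht.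
  rewrite gt_max lt_min => /andP[h2 h3] h4 /andP[h5 h6].
  by rewrite h1 h5 h2 h4 h6 h3.
exists (fun t => P (al t, be t) t); split=> [|t ht].
  have [|h1 h2 _] := adm c; first by rewrite ac cb.
  by have [] := hP (al c, be c) (conj h1 h2).
have [h1 h2 h3] := adm t ht.
have [_ dP] := hP (al t, be t) (conj h1 h2).
apply: near_eq_is_derive (dP t h3).
apply: (@open_near_eq _ _ [set s | al t < s < be t]) => //.
  have -> : [set s | al t < s < be t] = `]al t, be t[%classic.
    by apply/seteqP; split => s /=; rewrite in_itv.
  exact: interval_open.
move=> s /= hs.
have hs' : a < s < b.
  move: h1 h2 hs => /andP[u1 u2] /andP[u3 u4] /andP[u5 u6].
  by rewrite (lt_trans u1 u5) (lt_trans u6 u4).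
have [k1 k2 k3] := adm s hs'.
have [P1 dP1] := hP (al s, be s) (conj k1 k2).
have [P2 _] := hP (al t, be t) (conj h1 h2).
have hc' : Num.max (al t) (al s) < c < Num.min (be t) (be s).
  rewrite gt_max lt_min; case/andP: h1 => _ ->; case/andP: k1 => _ ->.
  by case/andP: h2 => ->; case/andP: k2 => ->.
apply: (is_derive_unique_on (df := h) hc'); first by rewrite P1 P2.
- by move=> u /andP[]; rewrite gt_max lt_min => /andP[? ?] /andP[? ?]; apply: dP; apply/andP.
- by move=> u /andP[]; rewrite gt_max lt_min => /andP[? ?] /andP[? ?]; apply: dP1; apply/andP.
by rewrite gt_max lt_min; case/andP: hs => -> ->; case/andP: k3 => -> ->.
Qed.

(** Gronwall's inequality without exponentials: at a point [s] where [|w|] is largest between [c]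
    and [t], the mean value theorem gives [|w s| <= (k |w s| + e) (b - a)], and [k (b - a) <= 1 / 2]
    absorbs the first term. *)
Lemma ode_bound (w dw : R -> R) a b c k e : a < c < b ->
  (forall t, a < t < b -> is_derive t (1 : R) w (dw t)) -> w c = 0 ->
  (forall t, a < t < b -> `|dw t| <= k * `|w t| + e) ->
  0 <= k -> k * (b - a) <= 1 / 2 -> 0 <= e ->
  forall t, a < t < b -> `|w t| <= 2 * e * (b - a).
Proof.
move=> hc dwP wc dwb k0 kab e0 t ht.
have mM : Num.min c t <= Num.max c t by rewrite ge_min le_max lexx.
have [|s] := @EVT_max R (fun s => `|w s|) _ _ mM.
  apply: continuous_in_subspaceT => s; rewrite inE/= in_itv/= => hs.
  apply: (@continuous_comp _ _ _ w Num.norm); last exact: norm_continuous.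
  exact/is_derive1_continuous/dwP/(between_itv hc ht).
rewrite in_itv/= => hs smax.
have hmem : t \in `[Num.min c t, Num.max c t] by rewrite in_itv/= ge_min le_max !lexx !orbT.
apply: le_trans (smax t hmem) _.
have habs := between_itv hc ht hs.
have [u hu|x hx] := @MVT_between R w dw c s.
  exact/dwP/(between_itv hc habs hu).
rewrite wc subr0 => ews.
have xin : Num.min c t <= x <= Num.max c t.
  move: hx hs; rewrite !ge_min !le_max => /andP[/orP h1 /orP h2] /andP[/orP h3 /orP h4].
  by apply/andP; split; apply/orP; case: h1; case: h2; case: h3; case: h4 => *; lra.
have hxs : `|w x| <= `|w s| by apply: smax; rewrite in_itv/= xin.
have sc := dist_itv hc habs.
have : `|w s| <= (k * `|w s| + e) * (b - a).
  rewrite {1}ews normrM; apply: ler_pM => //.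
  apply: le_trans (dwb x (between_itv hc ht xin)) _.
  by rewrite lerD2r ler_wpM2l.
have ab : 0 <= b - a by apply: le_trans sc.
have : k * (b - a) * `|w s| <= 1 / 2 * `|w s| by apply: ler_wpM2r.
nra.
Qed.

(** The intervals of radius [2 r / 2^n] around [u n] are nested, and the supremum of their left ends
    lies in all of them. *)
Lemma halving_limit (u : nat -> R) r :
  (forall n, `|u n.+1 - u n| <= r / 2 ^+ n) ->
  exists l, forall n, `|l - u n| <= 2 * r / 2 ^+ n.
Proof.
move=> hu; have p2 n : 0 < 2 ^+ n :> R by rewrite exprn_gt0.
pose q n : R := (2 ^+ n)^-1.
have q0 n : 0 < q n by rewrite invr_gt0.
have qS n : q n = 2 * q n.+1.
  by rewrite /q exprS invfM mulrA divff ?mul1r// pnatr_eq0.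
have {}hu n : u n - r * q n <= u n.+1 <= u n + r * q n.
  by have := hu n; rewrite -/(q n) ler_norml => /andP[? ?]; apply/andP; split; lra.
have r0 : 0 <= r.
  have /andP[h1 h2] := hu 0%N; have : q 0%N = 1 by rewrite /q expr0 invr1.
  by move=> q1; rewrite q1 in h1 h2; lra.
pose v n := u n - 2 * r * q n; pose w n := u n + 2 * r * q n.
have vI : nondecreasing_seq v.
  by apply/nondecreasing_seqP => n; rewrite /v; have /andP[] := hu n; rewrite (qS n); lra.
have wD : nonincreasing_seq w.
  by apply/nonincreasing_seqP => n; rewrite /w; have /andP[] := hu n; rewrite (qS n); lra.
have vw n m : v n <= w m.
  apply: (@le_trans _ _ (v (maxn n m))); first by apply: vI; rewrite leq_maxl.
  apply: (@le_trans _ _ (w (maxn n m))); last by apply: wD; rewrite leq_maxr.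
  rewrite /v /w; have := mulr_ge0 r0 (ltW (q0 (maxn n m))); lra.
exists (sup (range v)) => n.
have sv : v n <= sup (range v).
  apply: ub_le_sup; last by exists n.
  by exists (w 0%N) => _ [m _ <-].
have sw : sup (range v) <= w n.
  apply: ge_sup; first by exists (v 0%N), 0%N.
  by move=> _ [m _ <-].
move: sv sw; rewrite /v /w ler_norml -/(q n) => h1 h2.
by apply/andP; split; lra.
Qed.

(** The iteration contracts by 1/2 in the sup norm because [k (b - a) <= 1 / 2]. Continuity of [F]
    is asked along continuous curves, which is what forming a primitive of [F s (y s)] takes; the
    Lipschitz bound is global in [y]. *)
Lemma picard (F : R -> R -> R) a b c k M : a < c < b -> 0 <= k -> k * (b - a) <= 1 / 2 ->
  (forall t y z, a < t < b -> `|F t y - F t z| <= k * `|y - z|) ->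
  (forall y : R -> R, (forall t, a < t < b -> {for t, continuous y}) ->
     forall t, a < t < b -> {for t, continuous (fun s => F s (y s))}) ->
  (forall t, a < t < b -> `|F t 0| <= M) ->
  exists y : R -> R, y c = 0 /\ forall t, a < t < b -> is_derive t (1 : R) y (F t (y t)).
Proof.
move=> hc k0 kab FL Fc FM.
have ab : 0 < b - a by case/andP: hc => h1 h2; rewrite subr_gt0 (lt_trans h1).
have M0 : 0 <= M by apply: le_trans (FM c hc).
pose good (y : R -> R) := forall t, a < t < b -> {for t, continuous y}.
(* The condition on [y] stands under the existential, so that [choice] yields a total operator [P],
   meaningful on [good] curves. *)
have exP (y : R -> R) : exists z : R -> R, good y ->
    z c = 0 /\ forall t, a < t < b -> is_derive t (1 : R) z (F t (y t)).
  case: (pselect (good y)) => [gy|ng]; last by exists (fun=> 0) => /ng.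
  have [z hz] := @primitive_on_open (fun s => F s (y s)) a b c hc (Fc y gy).
  by exists z.
have [P hP] := choice exP.
have goodP y : good y -> good (P y).
  by move=> gy t ht; have [_ /(_ t ht)/is_derive1_continuous] := hP y gy.
pose Y n := iter n P (fun=> 0).
have goodY n : good (Y n).
  by elim: n => [t _|n IH]; [exact: cst_continuous|exact: goodP].
have contr y z e : good y -> good z -> 0 <= e -> (forall t, a < t < b -> `|y t - z t| <= e) ->
    forall t, a < t < b -> `|P y t - P z t| <= e / 2.
  move=> gy gz e0 yz t ht; have [Py dPy] := hP y gy; have [Pz dPz] := hP z gz.
  have [s hs|x hx] := @MVT_between R (fun s => P y s - P z s)
      (fun s => F s (y s) - F s (z s)) c t.
    by have h := between_itv hc ht hs; apply: is_deriveB; [exact: dPy|exact: dPz].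
  rewrite Py Pz subrr subr0 => ->; rewrite normrM.
  have hx' := between_itv hc ht hx.
  have tc := dist_itv hc ht.
  apply: (@le_trans _ _ (k * e * (b - a))); last by nra.
  apply: ler_pM => //; apply: le_trans (FL _ _ _ hx') _.
  by apply: ler_wpM2l => //; exact: yz.
pose r := M * (b - a).
have r0 : 0 <= r by rewrite mulr_ge0// ltW.
have step n : forall t, a < t < b -> `|Y n.+1 t - Y n t| <= r / 2 ^+ n.
  elim: n => [t ht|n IH].
    rewrite expr0 divr1 /= subr0; have [P0 dP0] := hP _ (goodY 0%N).
    have [s hs|x hx] := @MVT_between R (P (fun=> 0)) (fun s => F s 0) c t.
      exact/dP0/(between_itv hc ht hs).
    rewrite P0 subr0 => ->; rewrite normrM; apply: ler_pM => //.
      exact/FM/(between_itv hc ht hx).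
    exact: dist_itv hc ht.
  move=> t ht; rewrite exprSr invfM mulrA.
  by apply: (contr (Y n.+1) (Y n)) => //; rewrite divr_ge0// exprn_ge0.
have exl t : exists l, a < t < b -> forall n, `|l - Y n t| <= 2 * r / 2 ^+ n.
  case: (pselect (a < t < b)) => [ht|nt]; last by exists 0 => /nt.
  by have [l hl] := halving_limit (fun n => step n t ht); exists l.
have [y hy] := choice exl.
have small e : 0 < e -> exists n, 2 * r / 2 ^+ n < e.
  move=> e0; have [|n hn] := @halving_limit (fun n => 2 * r / 2 ^+ n) (2 * r).
    move=> n; rewrite exprS invfM.
    set q := (2 ^+ n)^-1; have q0 : 0 <= q by rewrite invr_ge0 exprn_ge0.
    rewrite (_ : 2 * r * (2^-1 * q) - 2 * r * q = - (r * q)); last by field.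
    by rewrite normrN ger0_norm ?mulr_ge0//; nra.
  have := @cvg_geometric R (2 * r) (1 / 2).
  rewrite ger0_norm// => /(_ _)/cvgrPdist_lt/(_ e e0) [|N _ /(_ N (leqnn N))].
    by lra.
  rewrite sub0r normrN /geometric/= => hN.
  exists N; apply: le_lt_trans hN; rewrite expr_div_n expr1n mul1r.
  exact: ler_norm.
have gy : good y.
  move=> t ht; apply/cvgrPdist_lt => e e0.
  have [n hn] := small (e / 3) (divr_gt0 e0 (ltr0n _ 3)).
  have e30 : 0 < e / 3 by rewrite divr_gt0.
  have h1 := cvg_dist_lt (goodY n t ht) e30.
  have h2 : \forall s \near t, a < s < b.
    case/andP: ht => h2 h3; near=> s; apply/andP; split; near: s.
      exact: lt_nbhsr.
    exact: lt_nbhsl.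
  apply: filterS2 h1 h2 => s h1 h2.
  have := hy t ht n; have := hy s h2 n.
  have := ler_distD (Y n t) (y t) (y s); have := ler_distD (Y n s) (Y n t) (y s).
  rewrite [`|Y n t - Y n s|]distrC [`|Y n s - y s|]distrC; lra.
exists y; have [Py dPy] := hP y gy.
(* Both [P y] and [y] are within [r / 2^n] of [Y n.+1], the former by contraction. *)
have E t : a < t < b -> P y t = y t.
  move=> ht; apply/eqP; rewrite -subr_eq0 -normr_le0.
  rewrite leNgt; apply/negP => d0.
  have [n hn] := small _ (divr_gt0 d0 (ltr0n _ 2)).
  have g0 : 0 <= 2 * r / 2 ^+ n.
    by apply: divr_ge0; [exact: mulr_ge0|exact: exprn_ge0].
  have g1 := contr y (Y n) _ gy (goodY n) g0 (fun s hs => hy s hs n) t ht.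
  have g2 := hy t ht n.+1.
  have := ler_distD (Y n.+1 t) (P y t) (y t); rewrite [`|Y n.+1 t - y t|]distrC.
  by move: g1 g2; rewrite /= exprS invfM; lra.
split=> [|t ht]; first by rewrite -E.
apply: near_eq_is_derive (dPy t ht).
apply: (@open_near_eq _ _ [set s | a < s < b]) => //.
have -> : [set s | a < s < b] = `]a, b[%classic.
  by apply/seteqP; split => s /=; rewrite in_itv.
exact: interval_open.
Unshelve. all: by end_near. Qed.

End ScalarODE.

(** * Primitives depending smoothly on parameters *)

Section Cylinder.
Variable R : realType.

Lemma is_derive_dist (V : normedModType R) (f : V -> R) (z v : V) (d : R) :
  (forall e, 0 < e -> exists2 r : R, 0 < r & forall h : R, `|h| < r ->
     `|f (h *: v + z) - f z - h * d| <= e * `|h|) ->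
  is_derive z v f d.
Proof.
move=> H.
suff cv : (fun h => h^-1 *: ((f \o shift z) (h *: v) - f z)) @ 0^' --> d.
  by split; [apply/cvg_ex; exists d|apply: cvg_lim cv].
apply/cvgrPdist_le => e e0; have [r r0 hr] := H e e0.
near=> h.
have h0 : h != 0 by near: h; exact: nbhs_dnbhs_neq.
have hh : `|h| < r by near: h; exact: dnbhs0_lt.
have E : f (h *: v + z) - f z - h * d = h * (h^-1 * (f (h *: v + z) - f z) - d).
  by rewrite mulrBr mulrA divff// mul1r.
by have := hr h hh; rewrite E normrM mulrC ler_pM2r ?normr_gt0// distrC.
Unshelve. all: by end_near. Qed.

(** A directional derivative sees only the restriction to a line, so it can be carried between [R],
    space and space-time. *)
Lemma is_derive_transfer (V V' : normedModType R) (f : V -> R) (g : V' -> R)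
    (z v : V) (z' v' : V') (d : R) :
  (forall h, f (h *: v + z) = g (h *: v' + z')) -> is_derive z' v' g d -> is_derive z v f d.
Proof.
move=> fg.
have fg0 : f z = g z' by have := fg 0; rewrite !scale0r !add0r.
have E : (fun h : R => h^-1 *: ((f \o shift z) (h *: v) - f z)) =
    (fun h : R => h^-1 *: ((g \o shift z') (h *: v') - g z')).
  by apply/funext => h /=; rewrite fg fg0.
by move=> [dg <-]; split; rewrite /derivable /derive E.
Qed.

Lemma is_derive_of_line (V : normedModType R) (f : V -> R) (g : R -> R) (z v : V) (t d : R) :
  (forall h, f (h *: v + z) = g (h + t)) -> is_derive t (1 : R) g d -> is_derive z v f d.
Proof. by move=> fg; apply: is_derive_transfer => h; rewrite fg [h *: 1]mulr1. Qed.

Variables (N : nat) (a b c : R) (D : set 'rV[R]_N.+1).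
Hypotheses (hc : a < c < b) (oD : open D).
Local Notation Z := 'rV[R]_N.+1.
Local Notation e0 := (delta_mx 0 0 : Z).

(** Coordinate 0 is time, with initial value [c]. [Dt] and [Dupd] say that [D] is a union of full
    vertical segments over []a, b[]; [upd] moves a point along its segment. *)
Definition upd (z : Z) (t : R) : Z := (t - z 0 0) *: e0 + z.

Hypotheses (Dt : forall z, D z -> a < z 0 0 < b)
  (Dupd : forall z t, D z -> a < t < b -> D (upd z t)).

Lemma upd0 z t : (upd z t) 0 0 = t.
Proof. by rewrite !mxE eqxx mulr1 subrK. Qed.

Lemma upd_upd z s t : upd (upd z s) t = upd z t.
Proof. by rewrite {1}/upd upd0 /upd addrA -scalerDl addrA subrK. Qed.

Lemma upd_id z : upd z (z 0 0) = z.
Proof. by rewrite /upd subrr scale0r add0r. Qed.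

Lemma upd_shift0 z h : h *: e0 + z = upd z (h + z 0 0).
Proof. by rewrite /upd addrK. Qed.

Lemma delta_shift0 i (z : Z) h : i != 0 -> (h *: delta_mx 0 i + z) 0 0 = z 0 0.
Proof. by move=> i0; rewrite !mxE eqxx/= eq_sym (negPf i0) mulr0 add0r. Qed.

Lemma upd_shift i z h t : i != 0 ->
  upd (h *: delta_mx 0 i + z) t = h *: delta_mx 0 i + upd z t.
Proof. by move=> i0; rewrite /upd delta_shift0// addrCA. Qed.

Lemma upd_continuous : continuous (fun p : R * Z => upd p.2 p.1).
Proof.
move=> p; apply: cvgD; last exact: cvg_snd.
apply: cvgZr_tmp; apply: cvgB; first exact: cvg_fst.
apply: (@continuous_comp _ _ _ snd (fun z : Z => z 0 0)); first exact: cvg_snd.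
exact: coord_continuous.
Qed.

Lemma cylinder_line_continuous (g : Z -> R) z t : Cdiff 0 D g -> D z -> a < t < b ->
  {for t, continuous (fun s => g (upd z s))}.
Proof.
move=> cg Dz ht.
apply: (@continuous_comp _ _ _ (fun s => upd z s) g); last exact/cg/Dupd.
apply: cvgD; last exact: cvg_cst.
by apply: cvgZr_tmp; apply: cvgB; [exact: cvg_id|exact: cvg_cst].
Qed.

(** Compactness of [[al, be]] makes the neighbourhood of [z] independent of [t], as in the tube
    lemma. *)
Lemma segment_equicontinuous (g : Z -> R) z al be e : Cdiff 0 D g -> D z -> a < al -> be < b -> 0 < e ->
  \forall z' \near z, forall t, al <= t <= be -> `|g (upd z' t) - g (upd z t)| < e.
Proof.
move=> cg Dz aal beb epos.
have := (compact_near_coveringP `[al, be]%classic).1 (@segment_compact _ _ _) Z (nbhs z)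
  (fun z' t => `|g (upd z' t) - g (upd z t)| < e) _.
suff H : forall t, `[al, be]%classic t -> \forall t' \near t & z' \near z,
    `|g (upd z' t') - g (upd z t')| < e.
  move=> /(_ _ H) H1; apply: filterS H1 => z' h t ht.
  by apply: h; rewrite /= in_itv.
move=> t; rewrite /= in_itv/= => /andP[t1 t2].
have ht : a < t < b by rewrite (lt_le_trans aal)// (le_lt_trans t2).
have e2 : 0 < e / 2 by rewrite divr_gt0.
have cg2 : {for (t, z), continuous (fun p : R * Z => g (upd p.2 p.1))}.
  apply: (@continuous_comp _ _ _ (fun p : R * Z => upd p.2 p.1) g).
    exact: upd_continuous.
  exact/cg/Dupd.
have cg1 := cylinder_line_continuous cg Dz ht.
have n1 : \forall p \near (t, z), `|g (upd z p.1) - g (upd z t)| < e / 2.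
  exact: (cvg_fst (cvg_dist_lt cg1 e2)).
apply: filterS2 n1 (cvg_dist_lt cg2 e2) => -[s z'] /= h1 h2.
have := ler_distD (g (upd z t)) (g (upd z' s)) (g (upd z s)).
rewrite [`|g (upd z t) - _|]distrC; lra.
Qed.

Lemma is_derive_upd (G : Z -> R) z t d : is_derive (upd z t) e0 G d ->
  is_derive t (1 : R) (fun s => G (upd z s)) d.
Proof.
move=> [dG <-]; have -> : (fun s => G (upd z s)) = (fun s => G (s *: e0 + upd z 0)).
  by apply/funext => s; rewrite upd_shift0 upd0 addr0 upd_upd.
have E : upd z t = t *: e0 + upd z 0 by rewrite upd_shift0 upd0 addr0 upd_upd.
by rewrite E in dG *; exact: is_derive_line.
Qed.

Lemma cylinder_primitive (g : Z -> R) : Cdiff 0 D g ->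
  exists G : Z -> R, forall z, D z -> G (upd z c) = 0 /\ is_derive z e0 G (g z).
Proof.
move=> cg.
have exP (h : R -> R) : exists H : R -> R, (forall t, a < t < b -> {for t, continuous h}) ->
    H c = 0 /\ forall t, a < t < b -> is_derive t (1 : R) H (h t).
  case: (pselect (forall t, a < t < b -> {for t, continuous h})) => [ch|nh].
    by have [H hH] := primitive_on_open hc ch; exists H.
  by exists (fun=> 0) => /nh.
have [P hP] := choice exP.
(* [P] takes the slice of [g] as its argument, and all points of a vertical segment have the same
   slice; along a segment, [G] therefore runs through the values of a single primitive. *)
exists (fun z => P (fun t => g (upd z t)) (z 0 0)) => z Dz.
have [|P0 dP] := hP (fun t => g (upd z t)).
  by move=> t ht; exact: cylinder_line_continuous.
have E s : (fun t => g (upd (upd z s) t)) = (fun t => g (upd z t)).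
  by apply/funext => t; rewrite upd_upd.
split; first by rewrite E upd0.
have := dP _ (Dt Dz); rewrite upd_id; apply: is_derive_of_line => h.
by rewrite upd_shift0 E upd0.
Qed.

Section Primitive.
Variables (g G : Z -> R).
Hypothesis hG : forall z, D z -> G (upd z c) = 0 /\ is_derive z e0 G (g z).

Lemma primitive_upd z t : D z -> a < t < b ->
  is_derive t (1 : R) (fun s => G (upd z s)) (g (upd z t)).
Proof. by move=> Dz ht; apply: is_derive_upd; have [] := hG (Dupd Dz ht). Qed.

Lemma segment_around t : a < t < b -> exists al be : R, [/\ a < al, be < b,
  al < t < be & forall s u, al < u < be -> Num.min c u <= s <= Num.max c u -> al <= s <= be].
Proof.
move=> /andP[h1 h2]; case/andP: (hc) => h3 h4.
exists ((a + Num.min c t) / 2), ((b + Num.max c t) / 2).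
have m1 : a < Num.min c t by rewrite lt_min h1 h3.
have m2 : Num.max c t < b by rewrite gt_max h2 h4.
have [k1 k2] : Num.min c t <= c /\ Num.min c t <= t by rewrite !ge_min !lexx orbT.
have [k3 k4] : c <= Num.max c t /\ t <= Num.max c t by rewrite !le_max !lexx orbT.
move: (Num.min c t) (Num.max c t) m1 m2 k1 k2 k3 k4 => m M *.
split; [lra|lra|by apply/andP; split; lra|move=> s u /andP[u1 u2]].
by rewrite ge_min le_max => /andP[/orP[?|?] /orP[?|?]]; apply/andP; split; lra.
Qed.

(** [G z'] is compared with the value of [G] at the same time on the segment of [z], by
    equicontinuity of [g]; then the time varies along that segment. *)
Lemma primitive_continuous : Cdiff 0 D g -> Cdiff 0 D G.
Proof.
move=> cg z Dz; apply: continuous_of_dist_le => e epos.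
have [al [be [h1 h2 h3 h4]]] := segment_around (Dt Dz).
have ab : 0 < b - a by case/andP: hc; lra.
pose e' := e / 2 / (b - a).
have e'0 : 0 < e' by rewrite !divr_gt0.
have e2 : 0 < e / 2 by rewrite divr_gt0.
have n1 := segment_equicontinuous cg Dz h1 h2 e'0.
have n2 := cvg_dist_lt (is_derive1_continuous (primitive_upd Dz (Dt Dz))) e2.
have cz : {for z, continuous (fun z' : Z => z' 0 0)} by exact: coord_continuous.
have n3 : nbhs z [set z' : Z | `|G (upd z (z' 0 0)) - G (upd z (z 0 0))| < e / 2] := cz _ n2.
have n4 : nbhs z [set z' : Z | al < z' 0 0 < be].
  exact: near_between cz h3.
have n5 : nbhs z D by exact: open_nbhs_nbhs.
apply: filterS3 n1 n4 (filterI n5 n3) => z' m1 m2 [m3 m4].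
have [s hs|x hx] := @MVT_between R (fun s => G (upd z' s) - G (upd z s))
    (fun s => g (upd z' s) - g (upd z s)) c (z' 0 0).
  by apply: is_deriveB; apply: primitive_upd => //; exact: between_itv (Dt m3) hs.
rewrite upd_id (hG Dz).1 (hG m3).1 !subr0 => E.
have : `|G z' - G (upd z (z' 0 0))| <= e / 2.
  rewrite E normrM; have -> : e / 2 = e' * (b - a) by rewrite /e' divfK// gt_eqF.
  apply: ler_pM => //; first by apply: ltW; apply: m1; exact: h4 m2 hx.
  exact: dist_itv hc (Dt m3).
rewrite upd_id in m4; have := ler_distD (G (upd z (z' 0 0))) (G z) (G z').
rewrite [`|G z - G z'|]distrC [`|G z - G (upd _ _)|]distrC.
rewrite [`|G (upd _ _) - G z'|]distrC; move: m4 => /=; lra.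
Qed.

(** Differentiation under the integral sign, without integrals: the error of the linear
    approximation of [G] vanishes at time [c], and its time derivative is the corresponding error
    for [g], which equicontinuity of [partial i g] makes small uniformly on the segment. *)
Lemma primitive_partial i (Gi : Z -> R) : i != 0 -> Cdiff 1 D g ->
  (forall z, D z -> Gi (upd z c) = 0 /\ is_derive z e0 Gi (partial i g z)) ->
  forall z, D z -> is_derive z (delta_mx 0 i) G (Gi z).
Proof.
move=> i0 [dg pg] hGi z Dz; apply: is_derive_dist => e epos.
have [al [be [h1 h2 h3 h4]]] := segment_around (Dt Dz).
have ab : 0 < b - a by case/andP: hc; lra.
pose e' := e / (b - a); have e'0 : 0 < e' by rewrite divr_gt0.
have n1 := segment_equicontinuous (pg i) Dz h1 h2 e'0.
have n2 : nbhs z D by exact: open_nbhs_nbhs.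
have [r r0 hr] := (near_normP _ _).1 (filterI n1 n2).
exists r => // h hh.
have near_pt s : `|s| <= `|h| -> `|s *: delta_mx 0 i + z - z| < r.
  move=> hs; rewrite addrK; apply: le_lt_trans hh; apply: rV_norm_le => j.
  rewrite !mxE eqxx/=; case: (j == i); rewrite ?mulr1 ?mulr0 ?normr0//.
have [_ Dhz] := hr _ (near_pt h (lexx _)).
have [s hs|x hx] := @MVT_between R
    (fun s => G (upd (h *: delta_mx 0 i + z) s) - G (upd z s) - h * Gi (upd z s))
    (fun s => g (upd (h *: delta_mx 0 i + z) s) - g (upd z s) - h * partial i g (upd z s))
    c (z 0 0).
  have hs' := between_itv hc (Dt Dz) hs.
  apply: is_deriveB; first by apply: is_deriveB; exact: primitive_upd.
  apply: (@is_deriveZ _ _ _ (fun s => Gi (upd z s)) h).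
  by apply: is_derive_upd; have [] := hGi _ (Dupd Dz hs').
have E0 : upd (h *: delta_mx 0 i + z) (z 0 0) = h *: delta_mx 0 i + z.
  by rewrite -(@delta_shift0 i z h i0) upd_id.
rewrite E0 upd_id (hG Dz).1 (hG Dhz).1 (hGi _ Dz).1 mulr0 !subr0 => ->.
have hx' := between_itv hc (Dt Dz) hx.
have [s hs|y hy] := @MVT_line R N g (upd z x) (delta_mx 0 i) h.
  have [_ Ds] := hr _ (near_pt s hs).
  by rewrite -upd_shift//; apply/diff_derivable/dg/Dupd.
rewrite -upd_shift// => ->.
have [/(_ x (h4 _ _ h3 hx)) hy' _] := hr _ (near_pt y hy).
rewrite -mulrBr !normrM -upd_shift//.
have -> : e * `|h| = `|h| * e' * (b - a) by rewrite -mulrA /e' divfK ?gt_eqF// mulrC.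
apply: ler_pM => //.
  by apply: ler_wpM2l => //; exact: ltW.
exact: dist_itv hc (Dt Dz).
Qed.

End Primitive.

(** In time the derivative of [G] is [g]; in space it is the primitive of a partial derivative of
    [g], to which the induction hypothesis applies. *)
Lemma Cdiff_primitive k (g G : Z -> R) : Cdiff k D g ->
  (forall z, D z -> G (upd z c) = 0 /\ is_derive z e0 G (g z)) -> Cdiff k D G.
Proof.
elim: k g G => [|k IH] g G cg hG; first exact: primitive_continuous hG cg.
have cg1 : Cdiff 1 D g by exact: Cdiff_le cg.
have derG i : exists Gi : Z -> R, Cdiff k D Gi /\
    forall z, D z -> is_derive z (delta_mx 0 i) G (Gi z).
  have [->|i0] := eqVneq i 0.
    by exists g; split; [exact: CdiffS|move=> z /hG[]].
  case: (cg) => _ /(_ i) pg.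
  have [Gi hGi] := cylinder_primitive (Cdiff_le (leq0n k) pg).
  exists Gi; split; first exact: IH pg hGi.
  exact: primitive_partial hG _ _ i0 cg1 hGi.
apply: CdiffS_of_partials => // i => [z Dz|]; have [Gi [cGi dGi]] := derG i.
  by have [] := dGi z Dz.
by apply: Cdiff_eq cGi => // z Dz; have [_ <-] := dGi z Dz.
Qed.

End Cylinder.

(** * Frobenius' theorem *)

Section SpaceTime.
Variables (R : realType) (n : nat).
Local Notation X := 'rV[R]_n.+1.
Local Notation Z := 'rV[R]_n.+2.

Definition space (z : Z) : X := \row_j z 0 (lift ord0 j).

Definition spacetime (t : R) (x : X) : Z :=
  \row_j (if unlift ord0 j is Some i then x 0 i else t).

Lemma spacetime0 t x : (spacetime t x) 0 0 = t.
Proof. by rewrite mxE; case: unliftP => //= j; rewrite /ord0 => /eqP. Qed.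

Lemma space_spacetime t x : space (spacetime t x) = x.
Proof. by apply/rowP => j; rewrite !mxE liftK. Qed.

Lemma space_upd z t : space (upd z t) = space z.
Proof.
by apply/rowP => j; rewrite !mxE eqxx/= mulr0 add0r.
Qed.

Lemma space_shift i h z :
  space (h *: delta_mx 0 (lift ord0 i) + z) = h *: delta_mx 0 i + space z.
Proof.
by apply/rowP => j; rewrite !mxE eqxx/= (inj_eq lift_inj).
Qed.

Lemma spacetime_shift i h t x :
  spacetime t (h *: delta_mx 0 i + x) = h *: delta_mx 0 (lift ord0 i) + spacetime t x.
Proof.
apply/rowP => j; rewrite !mxE eqxx/=; case: unliftP => [k ->|->].
  by rewrite (inj_eq lift_inj) !mxE eqxx.
by rewrite (negPf (neq_lift _ _)) mulr0 add0r.
Qed.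

Lemma norm_scale_delta m (c : R) (i : 'I_m.+1) :
  `|c *: (delta_mx 0 i : 'rV[R]_m.+1)| <= `|c|.
Proof.
apply: rV_norm_le => j; rewrite !mxE eqxx/=.
by case: (j == i); rewrite ?mulr1 ?mulr0 ?normr0.
Qed.

Definition tube_around (a b : R) (p : X) (dl : R) : set Z :=
  [set z : Z | a < z 0 0 < b /\ `|space z - p| < dl].

Lemma space_continuous : continuous space.
Proof.
move=> z; apply: continuous_rV => j.
rewrite (_ : (fun x => _) = (fun x : Z => x 0 (lift ord0 j))); first exact: coord_continuous.
by apply/funext => x; rewrite mxE.
Qed.

Lemma open_tube_around a b p dl : open (tube_around a b p dl).
Proof.
apply: openI.
  rewrite openE => z; apply: near_between; exact: coord_continuous.
apply: open_norm_lt => z; apply: (@continuousB _ _ _ _ (fun z : Z => p)).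
  exact: space_continuous.
exact: cst_continuous.
Qed.

End SpaceTime.

(** * First integral of a normalized form *)

Section Frobenius.
Variables (R : realType) (n : nat).
Local Notation X := 'rV[R]_n.+1.
Local Notation Z := 'rV[R]_n.+2.
Variables (V : set X) (p : X) (e : 'I_n.+1) (theta : 'I_n.+1 -> X -> R).
Hypotheses (oV : open V) (Vp : V p) (sm : forall j, smooth V (theta j)).
(* theta /\ d theta = 0, contracted with the e-th coordinate field, when theta_e = 1 *)
Hypothesis int : forall x, V x -> forall j k,
  partial j (theta k) x - partial k (theta j) x =
  theta j x * partial e (theta k) x - theta k x * partial e (theta j) x.

Let gam t x y : X := y *: delta_mx 0 e + (t *: (x - p) + p).
(** As [gamma' = y' e + (x - p)], for [theta_e = 1] the condition [theta(gamma') = 0] reads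
    [y' = F t x y]; [Fy] and [Fx i] are the partial derivatives of [F] in [y] and in [x_i]. *)
Let F t x y : R := - \sum_j theta j (gam t x y) * (x - p) 0 j.
Let Fy t x y : R := - \sum_j partial e (theta j) (gam t x y) * (x - p) 0 j.
Let Fx i t x y : R :=
  - (t * \sum_j partial i (theta j) (gam t x y) * (x - p) 0 j + theta i (gam t x y)).

Section Constants.
Variables (d C dl r : R).
(** With [|x - p| < dl], [|y| <= r] and [|t| <= 2], the curves stay in the [d]-ball, where [C]
    bounds [theta] and its first derivatives; [mu] then bounds [F], [Fy] and the Lipschitz constant
    of [F] in [y]. Times range over []-1, 2[], an open neighbourhood of [[0, 1]] of length 3: [mu1]
    is the contraction condition and [mu2] keeps solutions within [r]. *)
Let mu := n.+1%:R * C * dl.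
Hypotheses (C0 : 0 <= C) (dV : forall a, `|a - p| < d -> V a)
  (bC : forall j a, `|a - p| < d -> `|theta j a| <= C /\ forall i, `|partial i (theta j) a| <= C)
  (tC : forall j a b, `|a - p| < d -> `|b - p| < d ->
      `|theta j b - theta j a| <= C * `|b - a| /\
      `|theta j b - theta j a - \sum_i (b - a) 0 i * partial i (theta j) a| <= C * `|b - a| ^+ 2)
  (dl0 : 0 < dl) (r0 : 0 < r) (dlr : 2 * dl + r < d) (mu1 : mu * 3 <= 1 / 2) (mu2 : mu * 3 <= r).

Let inB x := `|x - p| < dl.
Let inI (t : R) := -1 < t < 2.

Lemma mu_ge0 : 0 <= mu.
Proof. by rewrite !mulr_ge0// ltW. Qed.

Lemma norm_t t : inI t -> `|t| <= 2.
Proof. by move=> /andP[? ?]; rewrite ler_norml; apply/andP; split; lra. Qed.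

Lemma gam_ball t x y : inI t -> inB x -> `|y| <= r -> `|gam t x y - p| < d.
Proof.
move=> ht hx hy; apply: le_lt_trans dlr; rewrite /gam addrA addrK addrC.
apply: le_trans (ler_normD _ _) _; apply: lerD; last exact: le_trans (norm_scale_delta _ _) hy.
by rewrite normrZ; apply: ler_pM => //; [exact: norm_t|exact: ltW].
Qed.

Lemma norm_sum_le (f : 'I_n.+1 -> R) M : (forall j, `|f j| <= M) ->
  `|\sum_j f j| <= n.+1%:R * M.
Proof.
move=> h; apply: le_trans (ler_norm_sum _ _ _) _.
have -> : n.+1%:R * M = \sum_(j < n.+1) M by rewrite sumr_const card_ord mulr_natl.
exact: ler_sum.
Qed.

Lemma F_bound t x y : inI t -> inB x -> `|y| <= r -> `|F t x y| <= mu.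
Proof.
move=> ht hx hy; rewrite normrN /mu -mulrA; apply: norm_sum_le => j.
rewrite normrM; apply: ler_pM => //; first by have [] := bC j (gam_ball ht hx hy).
exact: le_trans (rV_coord_le_norm _ _) (ltW hx).
Qed.

Lemma Fy_bound t x y : inI t -> inB x -> `|y| <= r -> `|Fy t x y| <= mu.
Proof.
move=> ht hx hy; rewrite normrN /mu -mulrA; apply: norm_sum_le => j.
rewrite normrM; apply: ler_pM => //; first by have [_] := bC j (gam_ball ht hx hy); exact.
exact: le_trans (rV_coord_le_norm _ _) (ltW hx).
Qed.

Lemma F_lip_y t x y z : inI t -> inB x -> `|y| <= r -> `|z| <= r ->
  `|F t x y - F t x z| <= mu * `|y - z|.
Proof.
move=> ht hx hy hz; rewrite /F -opprD normrN -sumrB /mu -!mulrA.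
apply: norm_sum_le => j; rewrite -mulrBl normrM [dl * _]mulrC mulrA.
apply: ler_pM => //; last exact: le_trans (rV_coord_le_norm _ _) (ltW hx).
have [h _] := tC j (gam_ball ht hx hz) (gam_ball ht hx hy).
apply: le_trans h _; apply: ler_wpM2l => //.
by rewrite /gam opprD addrACA subrr addr0 -scalerBl norm_scale_delta.
Qed.

Lemma F_lip_x t x x' y : inI t -> inB x -> inB x' -> `|y| <= r ->
  `|F t x' y - F t x y| <= n.+1%:R * (C * (1 + 2 * dl)) * `|x' - x|.
Proof.
move=> ht hx hx' hy; rewrite /F -opprD normrN -sumrB -!mulrA.
apply: norm_sum_le => j.
have -> : theta j (gam t x' y) * (x' - p) 0 j - theta j (gam t x y) * (x - p) 0 j =
  theta j (gam t x' y) * (x' - x) 0 j +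
  (theta j (gam t x' y) - theta j (gam t x y)) * (x - p) 0 j.
  by rewrite !mxE; ring.
have -> : C * ((1 + 2 * dl) * `|x' - x|) = C * `|x' - x| + C * (2 * dl * `|x' - x|) by ring.
apply: le_trans (ler_normD _ _) _; rewrite !normrM; apply: lerD.
  apply: ler_pM => //; last exact: rV_coord_le_norm.
  by have [] := bC j (gam_ball ht hx' hy).
have -> : C * (2 * dl * `|x' - x|) = C * (2 * `|x' - x|) * dl by ring.
apply: ler_pM => //; last exact: le_trans (rV_coord_le_norm _ _) (ltW hx).
have [h _] := tC j (gam_ball ht hx hy) (gam_ball ht hx' hy).
apply: le_trans h _; apply: ler_wpM2l => //.
have -> : gam t x' y - gam t x y = t *: (x' - x).
  by apply/rowP => k; rewrite !mxE; ring.
by rewrite normrZ; apply: ler_wpM2r => //; exact: norm_t.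
Qed.

(** The shift of [x] enters twice: it moves the point of evaluation by [t h e_i], which produces the
    sum in [Fx], and it changes the factor [x - p], which produces the term [theta i]. Since
    [|g' - g| <= 2 N], the Taylor remainders contribute [4 C dl] each and the cross term contributes
    [2 C]. *)
Lemma F_taylor i t x y h y' : inI t -> inB x -> inB (h *: delta_mx 0 i + x) ->
  `|y| <= r -> `|y'| <= r ->
  `|F t (h *: delta_mx 0 i + x) y' - F t x y - h * Fx i t x y - (y' - y) * Fy t x y| <=
  (n.+1%:R * (4 * C * dl) + 2 * C) * (`|h| + `|y' - y|) ^+ 2.
Proof.
move=> ht hx hx' hy hy'; set x' := h *: delta_mx 0 i + x.
set g := gam t x y; set g' := gam t x' y'; set w := y' - y; set N := `|h| + `|w|.
have N0 : 0 <= N by rewrite addr_ge0.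
have gg : g' - g = (t * h) *: delta_mx 0 i + w *: delta_mx 0 e.
  by apply/rowP => k; rewrite /g /g' /x' /w !mxE; ring.
have nk : `|g' - g| <= 2 * N.
  rewrite gg; apply: le_trans (ler_normD _ _) _; rewrite /N mulrDr; apply: lerD.
    apply: le_trans (norm_scale_delta _ _) _; rewrite normrM.
    by apply: ler_wpM2r => //; exact: norm_t.
  apply: le_trans (norm_scale_delta _ _) _.
  by rewrite ler_peMl// ler1n.
have gb := gam_ball ht hx hy; have gb' := gam_ball ht hx' hy'.
have lin j : \sum_k (g' - g) 0 k * partial k (theta j) g =
    t * h * partial i (theta j) g + w * partial e (theta j) g.
  by rewrite gg sum_delta2.
pose a j := (x - p) 0 j.
have -> : F t x' y' - F t x y - h * Fx i t x y - w * Fy t x y =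
  - (\sum_j (theta j g' - theta j g - \sum_k (g' - g) 0 k * partial k (theta j) g) * a j
     + h * (theta i g' - theta i g)).
  have E1 : \sum_j theta j g' * (x' - p) 0 j = \sum_j theta j g' * a j + h * theta i g'.
    rewrite (eq_bigr (fun j => theta j g' * a j + (if j == i then h * theta j g' else 0))).
      by rewrite big_split/= -big_mkcond/= big_pred1_eq.
    move=> j _; rewrite /a /x' !mxE eqxx/=.
    by case: (j == i); rewrite ?mulr1 ?mulr0; ring.
  have E2 : \sum_j (theta j g' - theta j g - \sum_k (g' - g) 0 k * partial k (theta j) g) * a j
     = \sum_j theta j g' * a j - \sum_j theta j g * a j
       - (t * h * \sum_j partial i (theta j) g * a j + w * \sum_j partial e (theta j) g * a j).
    rewrite !mulr_sumr -sumrB -big_split -sumrB; apply: eq_bigr => j _.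
    by rewrite lin /=; ring.
  rewrite E2 /F /Fx /Fy -/g -/g' E1 /a.
  have alg (s1 s2 s3 s4 u1 u2 : R) : - (s1 + h * u1) - - s2 - h * - (t * s3 + u2) - w * - s4 =
    - (s1 - s2 - (t * h * s3 + w * s4) + h * (u1 - u2)) by ring.
  exact: alg.
rewrite normrN; apply: le_trans (ler_normD _ _) _; rewrite mulrDl; apply: lerD.
  rewrite -mulrA; apply: norm_sum_le => j; rewrite normrM.
  have -> : 4 * C * dl * N ^+ 2 = C * (2 * N) ^+ 2 * dl by ring.
  apply: ler_pM => //; last exact: le_trans (rV_coord_le_norm _ _) (ltW hx).
  have [_ h2] := tC j gb gb'; apply: le_trans h2 _; apply: ler_wpM2l => //.
  by rewrite lerXn2r ?nnegrE// mulr_ge0.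
rewrite normrM; have -> : 2 * C * N ^+ 2 = N * (C * (2 * N)) by ring.
apply: ler_pM => //; first by rewrite /N lerDl.
have [h1 _] := tC i gb gb'; apply: le_trans h1 _.
exact: ler_wpM2l.
Qed.

(* [F t x] is only controlled for [|y| <= r]; clamping makes it globally Lipschitz, and
   the solution never reaches the clamped region. *)
Let clamp y : R := Num.max (- r) (Num.min r y).

Lemma clamp_norm y : `|clamp y| <= r.
Proof.
rewrite /clamp ler_norml le_max lexx/= ge_max; apply/andP; split; first by have := r0; lra.
by rewrite ge_min lexx.
Qed.

Lemma clamp_id y : `|y| <= r -> clamp y = y.
Proof. by rewrite ler_norml /clamp => /andP[h1 h2]; rewrite (min_idPr h2) (max_idPr h1). Qed.

Lemma clamp_lip y z : `|clamp y - clamp z| <= `|y - z|.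
Proof.
have r00 := r0; rewrite /clamp; case: (lerP r y) => h1; case: (lerP r z) => h2.
all: repeat match goal with |- context [Num.max ?u ?v] => case: (lerP u v) => ? end.
all: rewrite ler_norml; case: (ger0P (y - z)) => h3.
all: apply/andP; split; lra.
Qed.

Lemma itvI1 : inI 1.
Proof. by rewrite /inI; apply/andP; split; lra. Qed.

Lemma theta_Cdiff k j : Cdiff k [set a | `|a - p| < d] (theta j).
Proof. by apply: Cdiff_subset (sm j k) => a; exact: dV. Qed.

Lemma partial_theta_Cdiff k i j : Cdiff k [set a | `|a - p| < d] (partial i (theta j)).
Proof. by case: (theta_Cdiff k.+1 j) => _ /(_ i). Qed.

Lemma gam_line_continuous x (y : R -> R) t : {for t, continuous y} ->
  {for t, continuous (fun s => gam s x (y s))}.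
Proof.
move=> cy; apply: cvgD; first exact: cvgZr_tmp cy.
by apply: cvgD; [apply: cvgZr_tmp; exact: cvg_id|exact: cvg_cst].
Qed.

Lemma flow_exists x : inB x -> exists y : R -> R, y 1 = 0 /\
  forall t, inI t -> is_derive t (1 : R) y (F t x (y t)) /\ `|y t| <= r.
Proof.
move=> hx.
have [|t y z ht|y cy t ht|t ht|y [y1 dy]] :=
    @picard R (fun t y => F t x (clamp y)) (-1) 2 1 mu mu itvI1 mu_ge0 _ _ _ _.
- by have := mu1; lra.
- apply: le_trans (F_lip_y ht hx (clamp_norm y) (clamp_norm z)) _.
  by apply: ler_wpM2l; [exact: mu_ge0|exact: clamp_lip].
- have cc : {for t, continuous (fun s => clamp (y s))}.
    apply: continuous_of_dist_le => eps e0.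
    apply: filterS (cvg_dist_lt (cy t ht) e0) => s hs.
    exact: le_trans (clamp_lip _ _) (ltW hs).
  apply: continuousN.
  have : forall j, {for t, continuous (fun s => theta j (gam s x (clamp (y s))) * (x - p) 0 j)}.
    move=> j; apply: (@continuousM _ _ _ (fun=> (x - p) 0 j)); last exact: cst_continuous.
    apply: (@continuous_comp _ _ _ (fun s => gam s x (clamp (y s))) (theta j)).
      exact: gam_line_continuous.
    by apply: (theta_Cdiff 0 j); exact: gam_ball ht hx (clamp_norm _).
  by move=> h; apply: cvg_big => [|j _]; [exact: add_continuous|exact: h].
- exact: F_bound ht hx (clamp_norm _).
(* The slope is at most [mu] and the time elapsed at most 3. *)
have yr t : inI t -> `|y t| <= r.
  move=> ht; have [s hs|s hs] := @MVT_between R y (fun t => F t x (clamp (y t))) 1 t.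
    exact/dy/(between_itv itvI1 ht hs).
  rewrite y1 subr0 => ->; apply: le_trans mu2; rewrite normrM.
  have hs' := between_itv itvI1 ht hs.
  apply: ler_pM => //; first exact: F_bound hs' hx (clamp_norm _).
  by apply: le_trans (dist_itv itvI1 ht) _; lra.
exists y; split=> // t ht; split; last exact: yr.
by rewrite -(clamp_id (yr t ht)); exact: dy.
Qed.

Section Flow.
Variable Y : X -> R -> R.
Hypothesis hY : forall x, inB x -> Y x 1 = 0 /\
  forall t, inI t -> is_derive t (1 : R) (Y x) (F t x (Y x t)) /\ `|Y x t| <= r.

Let D : set Z := tube_around (-1) 2 p dl.
Let flow (z : Z) : R := Y (space z) (z 0 0).
Let gamz (z : Z) := gam (z 0 0) (space z) (flow z).

Lemma D_time z : D z -> -1 < z 0 0 < 2. Proof. by case. Qed.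

Lemma D_upd z t : D z -> -1 < t < 2 -> D (upd z t).
Proof. by move=> [_ h] ht; split; rewrite ?upd0// space_upd. Qed.

Lemma open_D : open D. Proof. exact: open_tube_around. Qed.

Lemma flow_upd (z : Z) t : flow (upd z t) = Y (space z) t.
Proof. by rewrite /flow space_upd upd0. Qed.

Let K := n.+1%:R * (C * (1 + 2 * dl)).
Let L := 2 * K * 3.

Lemma K_ge0 : 0 <= K.
Proof. by rewrite !mulr_ge0// addr_ge0// mulr_ge0// ltW. Qed.

(** [Y] was chosen separately for each [x], so its regularity in [x] starts here. The difference of
    two solutions obeys [ode_bound] with error [K |x' - x|], where [K] is the Lipschitz constant of
    [F] in [x]; hence [L] is 2 times [K] times the length 3. *)
Lemma flow_lip x x' t : inB x -> inB x' -> inI t -> `|Y x' t - Y x t| <= L * `|x' - x|.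
Proof.
move=> hx hx' ht; have [Y1 dY] := hY hx; have [Y1' dY'] := hY hx'.
have -> : L * `|x' - x| = 2 * (K * `|x' - x|) * (2 - -1) by rewrite /L; ring.
apply: (@ode_bound R (fun t => Y x' t - Y x t) (fun t => F t x' (Y x' t) - F t x (Y x t))
  (-1) 2 1 mu (K * `|x' - x|)) => //.
- exact: itvI1.
- by move=> s hs; apply: is_deriveB; [have [] := dY' s hs|have [] := dY s hs].
- by rewrite Y1 Y1' subrr.
- move=> s hs; have [_ h1] := dY' s hs; have [_ h2] := dY s hs.
  apply: le_trans (ler_distD (F s x' (Y x s)) _ _) _; apply: lerD.
    exact: F_lip_y.
  exact: F_lip_x.
- exact: mu_ge0.
- by have := mu1; lra.
- by rewrite mulr_ge0// K_ge0.
Qed.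

Lemma flow_continuous : Cdiff 0 D flow.
Proof.
move=> z Dz; have [Dz1 Dz2] := Dz; apply: continuous_of_dist_le => eps e0.
have [_ /(_ _ Dz1)[/is_derive1_continuous cY _]] := hY Dz2.
have e2 : 0 < eps / 2 by rewrite divr_gt0.
have cz : {for z, continuous (fun z : Z => z 0 0)} by exact: coord_continuous.
have n1 : nbhs z [set z' : Z | `|Y (space z) (z' 0 0) - Y (space z) (z 0 0)| < eps / 2]
  := cz _ (cvg_dist_lt cY e2).
have L0 : 0 < L + 1 by rewrite ltr_wpDl// mulr_ge0// mulr_ge0// K_ge0.
have n2 : nbhs z [set z' : Z | `|space z' - space z| < eps / 2 / (L + 1)].
  have eL : 0 < eps / 2 / (L + 1) by rewrite divr_gt0.
  apply/near_normP; exists (eps / 2 / (L + 1)) => // z' hz'.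
  apply: le_lt_trans hz'; apply: rV_norm_le => j.
  by rewrite !mxE; have := rV_coord_le_norm (z' - z) (lift ord0 j); rewrite !mxE.
have n3 : nbhs z D by apply: open_nbhs_nbhs; split; [exact: open_D|].
apply: filterS3 n1 n2 n3 => z' /= h1 h2 [h3 h4].
have h5 := flow_lip Dz2 h4 h3.
have h6 : (L + 1) * `|space z' - space z| <= eps / 2.
  by rewrite mulrC -ler_pdivlMr// ltW.
have := ler_distD (Y (space z) (z' 0 0)) (flow z') (flow z).
by rewrite /flow; move: (normr_ge0 (space z' - space z)); nra.
Qed.

Lemma gamz_D z : D z -> `|gamz z - p| < d.
Proof.
move=> [h1 h2]; apply: gam_ball => //.
by have [_ /(_ _ h1)[_]] := hY h2.
Qed.

Lemma gamz_Cdiff k : Cdiff k D flow -> forall j, Cdiff k D (fun z => gamz z 0 j).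
Proof.
move=> cf j; have oD := open_D.
apply: Cdiff_eq (_ : Cdiff k D (fun z => flow z * (delta_mx 0 e : X) 0 j +
   (z 0 0 * (z 0 (lift ord0 j) - p 0 j) + p 0 j))) => //.
  by move=> z _; rewrite /gamz /gam !mxE.
apply: CdiffD => //; first by apply: CdiffM => //; exact: Cdiff_cst.
apply: CdiffD => //; last exact: Cdiff_cst.
apply: CdiffM => //; first exact: Cdiff_coord.
by apply: CdiffB => //; [exact: Cdiff_coord|exact: Cdiff_cst].
Qed.

Lemma comp_gamz_Cdiff k f : Cdiff k [set a | `|a - p| < d] f -> Cdiff k D flow ->
  Cdiff k D (fun z => f (gamz z)).
Proof.
move=> cf cflow; apply: Cdiff_comp cf => //; first exact: open_D.
  exact: gamz_D.
exact: gamz_Cdiff.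
Qed.

Lemma sum_gamz_Cdiff k (f : 'I_n.+1 -> X -> R) :
  (forall j, Cdiff k [set a | `|a - p| < d] (f j)) -> Cdiff k D flow ->
  Cdiff k D (fun z => - \sum_j f j (gamz z) * (space z - p) 0 j).
Proof.
move=> cf cflow; have oD := open_D; apply: CdiffN => //; apply: Cdiff_sum => // j.
apply: CdiffM => //; first exact: comp_gamz_Cdiff.
apply: Cdiff_eq (_ : Cdiff k D (fun z => z 0 (lift ord0 j) - p 0 j)) => //.
  by move=> z _; rewrite !mxE.
by apply: CdiffB => //; [exact: Cdiff_coord|exact: Cdiff_cst].
Qed.

Section Derivative.
Variable J : Z -> R.
Hypothesis hJ : forall z, D z -> J (upd z 1) = 0 /\
  is_derive z (delta_mx 0 0 : Z) J (Fy (z 0 0) (space z) (flow z)).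

(** The candidate for [dy / dx_i]. For [theta_e = 1], [theta(d gamma / dx_i)] is
    [dy / dx_i + t theta_i(gamma)]; it equals [theta_i(x)] at [t = 1] and should solve [h' = Fy h],
    hence be [exp(J) theta_i(x)]. Solving for [dy / dx_i] gives the formula. *)
Let eta i (z : Z) : R := expR (J z) * theta i (space z) - z 0 0 * theta i (gamz z).

(* Integrability is what makes [eta i] solve the linearized equation. *)
Lemma eta_derive i z t : D z -> inI t ->
  is_derive t (1 : R) (fun s => eta i (upd z s))
    (Fy t (space z) (flow (upd z t)) * eta i (upd z t) + Fx i t (space z) (flow (upd z t))).
Proof.
move=> Dz ht; have Du := D_upd Dz ht; case: (Dz) => Dz1 Dz2.
set x := space z; have [Y1 dY] := hY Dz2.
have [dYt Yr] := dY t ht; rewrite -/x in dYt Yr.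
pose phi s := gam s x (Y x s).
have dphi j : is_derive t (1 : R) (fun s => phi s 0 j)
    ((x - p) 0 j + (j == e)%:R * F t x (Y x t)).
  have -> : (fun s => phi s 0 j) =
      (fun s : R => (j == e)%:R *: Y x s + (s * (x - p) 0 j + p 0 j)).
    by apply/funext => s; rewrite /phi /gam !mxE eqxx/= mulrC.
  rewrite [X in is_derive _ _ _ X](_ : _ = (j == e)%:R * F t x (Y x t) + (1 * (x - p) 0 j + 0)); last by ring.
  have dA : is_derive t (1 : R) (fun s => s * (x - p) 0 j + p 0 j) (1 * (x - p) 0 j + 0).
    apply: is_derive_dist => eps e0; exists 1 => // h _.
    rewrite [_ *: _]mulr1; set u := (x - p) 0 j.
    have -> : (h + t) * u + p 0 j - (t * u + p 0 j) - h * (1 * u + 0) = 0 by ring.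
    by rewrite normr0 mulr_ge0// ltW.
  exact: is_deriveD (is_deriveZ ((j == e)%:R) dYt) dA.
have phi_d : `|phi t - p| < d by exact: gam_ball.
have dth : is_derive t (1 : R) (theta i \o phi)
    (\sum_j (x - p) 0 j * partial j (theta i) (phi t) + F t x (Y x t) * partial e (theta i) (phi t)).
  have dphi' j : differentiable (fun s => phi s 0 j) t.
    by apply/derivable1_diffP; have [] := dphi j.
  have dti : differentiable (theta i) (phi t).
    by case: (theta_Cdiff 1 i) => + _; exact.
  split; first exact/derivable1_diffP/differentiable_comp/dti/differentiable_rV.
  rewrite derive_comp_rV//.
  rewrite (eq_bigr (fun j => (x - p) 0 j * partial j (theta i) (phi t) +
     (if j == e then F t x (Y x t) * partial j (theta i) (phi t) else 0))).
    by rewrite big_split/= -big_mkcond/= big_pred1_eq.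
  move=> j _; have [_ ->] := dphi j.
  by case: (j == e); rewrite ?mul1r ?mul0r ?addr0; ring.
have dJ : is_derive t (1 : R) (fun s => J (upd z s)) (Fy t x (Y x t)).
  apply: is_derive_upd; have [_] := hJ Du.
  by rewrite upd0 space_upd flow_upd.
have dE : is_derive t (1 : R) (fun s => expR (J (upd z s)))
    (Fy t x (Y x t) * expR (J (upd z t))).
  have := is_derive1_comp (is_derive_expR (J (upd z t))) dJ.
  by move=> h; apply: is_derive_eq h _; rewrite /= mulrC.
have -> : (fun s => eta i (upd z s)) =
    (fun s => theta i x *: expR (J (upd z s)) - s * theta i (phi s)).
  by apply/funext => s; rewrite /eta /gamz flow_upd space_upd upd0 mulrC.
have dM := @is_deriveM _ _ id (theta i \o phi) t (1 : R) _ _ (is_derive_id t (1 : R)) dth.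
have dB := is_deriveB (is_deriveZ (theta i x) dE) dM.
apply: is_derive_eq dB _.
rewrite /eta /gamz flow_upd space_upd upd0 -/x -/(phi t) /=.
have Vphi := dV phi_d.
(* This is [int] contracted with [x - p]. The middle term on the right cancels the contribution of
   the motion [y'] along [e]. *)
have key : \sum_j (x - p) 0 j * partial j (theta i) (phi t) =
    \sum_j partial i (theta j) (phi t) * (x - p) 0 j
    + (\sum_j theta j (phi t) * (x - p) 0 j) * partial e (theta i) (phi t)
    - theta i (phi t) * \sum_j partial e (theta j) (phi t) * (x - p) 0 j.
  rewrite mulr_suml mulr_sumr -big_split -sumrB; apply: eq_bigr => j _.
  rewrite /=; have := int Vphi j i.
  set u1 := partial j (theta i) _; set u2 := partial i (theta j) _.
  by move=> /eqP; rewrite subr_eq => /eqP ->; ring.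
rewrite key /F /Fy /Fx -/(phi t).
set s1 := \sum_j theta j (phi t) * (x - p) 0 j.
set s2 := \sum_j partial e (theta j) (phi t) * (x - p) 0 j.
set s3 := \sum_j partial i (theta j) (phi t) * (x - p) 0 j.
set th := theta i (phi t).
set E := expR (J (upd z t)); set thx := theta i x; set dei := partial e (theta i) (phi t).
have alg : thx * (- s2 * E) - (t * (s3 + s1 * dei - th * s2 + - s1 * dei) + th * 1) =
  - s2 * (E * thx - t * th) + - (t * s3 + th) by ring.
exact: alg.
Qed.

Lemma eta_upd1 i z : D z -> eta i (upd z 1) = 0.
Proof.
move=> Dz; have [J1 _] := hJ Dz; have [Y1 _] := hY Dz.2.
rewrite /eta /gamz flow_upd space_upd upd0 J1 expR0 Y1 /gam.
by rewrite scale0r add0r scale1r subrK !mul1r subrr.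
Qed.

(** The error [w] satisfies [w' = Fy w] up to a remainder that [F_taylor] and [flow_lip] make of
    order [h^2]. It vanishes at time 1, so [ode_bound] gives [|w| <= K3 h^2]; the 6 in [K3] is 2
    times the length 3. *)
Lemma flow_derive i z : D z ->
  is_derive z (delta_mx 0 (lift ord0 i) : Z) flow (eta i z).
Proof.
move=> Dz; case: (Dz) => Dz1 Dz2; apply: is_derive_dist => eps e0.
pose K2 := n.+1%:R * (4 * C * dl) + 2 * C.
have K20 : 0 <= K2.
  by apply: addr_ge0; apply: mulr_ge0 => //; apply: mulr_ge0; [exact: mulr_ge0|exact: ltW].
have L0 : 0 <= L by rewrite mulr_ge0// mulr_ge0// K_ge0.
pose K3 := K2 * (1 + L) ^+ 2 * 6.
have K2L : 0 <= K2 * (1 + L) ^+ 2.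
  by apply: mulr_ge0 => //; apply: exprn_ge0; exact: addr_ge0.
have K30 : 0 <= K3 by exact: mulr_ge0.
have K31 : 0 < K3 + 1 by rewrite ltr_wpDl.
have n1 : nbhs z D by apply: open_nbhs_nbhs; split; [exact: open_D|].
have [rho rho0 hrho] := (near_normP _ _).1 n1.
exists (Num.min rho (eps / (K3 + 1))); first by rewrite lt_min rho0 divr_gt0.
move=> h; rewrite lt_min => /andP[h1 h2].
set z' := h *: delta_mx 0 (lift ord0 i) + z.
have Dz' : D z'.
  by apply: hrho; rewrite /z' addrK; apply: le_lt_trans (norm_scale_delta _ _) h1.
have sz' : space z' = h *: delta_mx 0 i + space z by rewrite /z' space_shift.
have tz' : z' 0 0 = z 0 0 by rewrite /z' delta_shift0// eq_sym neq_lift.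
set x := space z; set x' := space z' in sz' *.
have hx : inB x by [].
have hx' : inB x' by case: Dz'.
pose w s := Y x' s - Y x s - h * eta i (upd z s).
pose dw s := F s x' (Y x' s) - F s x (Y x s)
  - h * (Fy s x (Y x s) * eta i (upd z s) + Fx i s x (Y x s)).
have bound : `|w (z 0 0)| <= 2 * (K2 * (1 + L) ^+ 2 * `|h| ^+ 2) * (2 - -1).
  have [Y1' dY'] := hY hx'; have [Y1 dY] := hY hx.
  apply: (@ode_bound R w dw (-1) 2 1 mu (K2 * (1 + L) ^+ 2 * `|h| ^+ 2)) => //.
  - exact: itvI1.
  - move=> s hs; apply: is_deriveB.
      by apply: is_deriveB; [have [] := dY' s hs|have [] := dY s hs].
    apply: (@is_deriveZ _ _ _ (fun s => eta i (upd z s)) h).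
    by have := eta_derive i Dz hs; rewrite flow_upd.
  - by rewrite /w Y1 Y1' eta_upd1// mulr0 !subrr.
  - move=> s hs; have [_ b'] := dY' s hs; have [_ b] := dY s hs.
    have bx : inB (h *: delta_mx 0 i + x) by rewrite -sz'.
    have := F_taylor hs hx bx b b'; rewrite -sz' => T.
    have -> : dw s = (F s x' (Y x' s) - F s x (Y x s) - h * Fx i s x (Y x s)
        - (Y x' s - Y x s) * Fy s x (Y x s)) + Fy s x (Y x s) * w s.
      rewrite /dw /w; move: (eta i _) (Fy _ _ _) (Fx _ _ _ _) (F _ x' _) (F _ x _) => u1 u2 u3 u4 u5.
      ring.
    rewrite addrC; apply: le_trans (ler_normD _ _) _; apply: lerD.
      by rewrite normrM; apply: ler_wpM2r => //; exact: Fy_bound.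
    apply: le_trans T _; rewrite -/K2 -(mulrA K2); apply: ler_wpM2l => //.
    rewrite -exprMn lerXn2r ?nnegrE ?mulr_ge0 ?addr_ge0//.
    rewrite mulrDl mul1r lerD2l; apply: le_trans (flow_lip hx hx' hs) _.
    apply: ler_wpM2l => //.
    by rewrite sz' addrK norm_scale_delta.
  - exact: mu_ge0.
  - by have := mu1; lra.
  - by apply: mulr_ge0 => //; exact: exprn_ge0.
have -> : flow z' - flow z - h * eta i z = w (z 0 0).
  by rewrite /w upd_id /flow tz'.
apply: le_trans bound _.
have h3 : `|h| * (K3 + 1) <= eps by rewrite -ler_pdivlMr// ltW.
have -> : 2 * (K2 * (1 + L) ^+ 2 * `|h| ^+ 2) * (2 - -1) = K3 * `|h| * `|h| by rewrite /K3; ring.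
by apply: ler_wpM2r => //; move: (normr_ge0 h) => ?; nra.
Qed.

(** [F] and [eta] contain the flow and [J] undifferentiated. [J] inherits order [k] from the flow,
    so the first derivatives of the flow have order [k] and the flow gains one order. *)
Lemma flow_Cdiff k : Cdiff k D flow.
Proof.
elim: k => [|k IH]; first exact: flow_continuous.
have oD := open_D.
have cJ : Cdiff k D J.
  apply: (@Cdiff_primitive R n.+1 (-1) 2 1 D itvI1 oD D_time D_upd k
    (fun z => Fy (z 0 0) (space z) (flow z))) => //.
  by apply: (@sum_gamz_Cdiff k (fun j => partial e (theta j))) => // j; exact: partial_theta_Cdiff.
have ceta i : Cdiff k D (eta i).
  apply: CdiffB => //; apply: CdiffM => //.
  - exact: Cdiff_expR.
  - apply: (@Cdiff_comp R n.+1 n k D [set a | `|a - p| < d] (@space R n)) => //.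
    + move=> z [_ h]; apply: lt_trans h _; apply: le_lt_trans dlr.
      by have := dl0; have := r0; lra.
    + move=> j; apply: Cdiff_eq (Cdiff_coord k D (lift ord0 j)) => // z _.
      by rewrite mxE.
    + exact: theta_Cdiff.
  - exact: Cdiff_coord.
  - by apply: comp_gamz_Cdiff => //; exact: theta_Cdiff.
have dF : Cdiff k D (fun z => F (z 0 0) (space z) (flow z)).
  by apply: (@sum_gamz_Cdiff k theta) => // j; exact: theta_Cdiff.
have d0F z : D z -> is_derive z (delta_mx 0 0 : Z) flow (F (z 0 0) (space z) (flow z)).
  move=> [h1 h2]; have [_ /(_ _ h1)[]] := hY h2.
  rewrite -/(flow z) => dYz _; apply: is_derive_of_line dYz => h.
  by rewrite upd_shift0 flow_upd.
apply: CdiffS_of_partials => // i; case: (unliftP ord0 i) => [j ->|->].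
- by move=> z Dz; have [] := flow_derive j Dz.
- by move=> z Dz; have [] := d0F z Dz.
- by apply: Cdiff_eq (ceta j) => // z Dz; have [_ <-] := flow_derive j Dz.
- by apply: Cdiff_eq dF => // z Dz; have [_ <-] := d0F z Dz.
Qed.

End Derivative.

Lemma open_inB : open [set x | inB x].
Proof.
apply: open_norm_lt => x; apply: (@continuousB _ _ _ _ (fun x : X => p)).
  exact: cvg_id.
exact: cst_continuous.
Qed.

Lemma flow_potential : exists u : X -> R, smooth [set x | inB x] u /\
  forall x, inB x -> exists2 c, 0 < c & forall i, partial i u x = c * theta i x.
Proof.
have oD := open_D.
have cFy : Cdiff 0 D (fun z => Fy (z 0 0) (space z) (flow z)).
  apply: (@sum_gamz_Cdiff 0 (fun j => partial e (theta j))); last exact: flow_continuous.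
  by move=> j; exact: partial_theta_Cdiff.
have [J hJ] := cylinder_primitive itvI1 D_time D_upd cFy.
have I0 : inI 0 by rewrite /inI; apply/andP; split; lra.
have D0 x : inB x -> D (spacetime 0 x) by move=> hx; split; rewrite ?spacetime0 ?space_spacetime.
exists (fun x => flow (spacetime 0 x)); split=> [k|x hx].
  apply: (@Cdiff_comp R n n.+1 k _ D (spacetime 0)) => //; last exact: flow_Cdiff hJ k.
    exact: open_inB.
  move=> j; case: (unliftP ord0 j) => [i ->|->].
    apply: Cdiff_eq (Cdiff_coord k [set x | inB x] i) => [|x _]; first exact: open_inB.
    by rewrite mxE liftK.
  apply: Cdiff_eq (Cdiff_cst k [set x | inB x] 0) => [|x _]; first exact: open_inB.
  by rewrite spacetime0.
exists (expR (J (spacetime 0 x))); first exact: expR_gt0.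
move=> i; have := flow_derive hJ i (D0 x hx).
(* At time 0 the second term of [eta i] drops out. *)
rewrite space_spacetime spacetime0 mul0r subr0 => df.
have [_ <- //] : is_derive x (delta_mx 0 i : X) (fun x => flow (spacetime 0 x))
  (expR (J (spacetime 0 x)) * theta i x).
by apply: is_derive_transfer df => h; rewrite spacetime_shift.
Qed.

End Flow.
End Constants.

Lemma first_integral_normalized : exists (W : set X) (u : X -> R),
  [/\ open W, W p, W `<=` V, smooth W u &
    forall x, W x -> exists2 c, 0 < c & forall i, partial i u x = c * theta i x].
Proof.
have [d [C [d0 C0 dV bC tC]]] := taylor2_near oV Vp (fun j => sm j 2).
pose A := n.+1%:R * C + 1; have A0 : 0 < A by rewrite ltr_wpDl// mulr_ge0.
pose r := d / 2; have r0 : 0 < r by rewrite divr_gt0.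
(* [A] exceeds [(n + 1) C] and is positive even if [C = 0]. The three bounds give, in turn,
   [2 dl + r < d], [3 mu <= 1 / 2] and [3 mu <= r]. *)
pose dl := Num.min (d / 8) (Num.min ((6 * A)^-1) (r / (3 * A))).
have dl0 : 0 < dl by rewrite !lt_min invr_gt0 !divr_gt0 ?mulr_gt0.
have dl1 : dl <= d / 8 by rewrite ge_min lexx.
have dl2 : dl * (6 * A) <= 1.
  by rewrite -ler_pdivlMr ?mulr_gt0// div1r /dl !ge_min lexx !orbT.
have dl3 : dl * (3 * A) <= r.
  by rewrite -ler_pdivlMr ?mulr_gt0// /dl !ge_min lexx !orbT.
have mu0 : n.+1%:R * C * dl <= A * dl.
  by apply: ler_wpM2r; rewrite /A ?lerDl ?ltW.
have dlr : 2 * dl + r < d by rewrite /r; lra.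
have mu1 : n.+1%:R * C * dl * 3 <= 1 / 2 by lra.
have mu2 : n.+1%:R * C * dl * 3 <= r by lra.
have exY x : exists y : R -> R, `|x - p| < dl -> y 1 = 0 /\
    forall t : R, -1 < t < 2 -> is_derive t (1 : R) y (F t x (y t)) /\ `|y t| <= r.
  case: (pselect (`|x - p| < dl)) => [hx|nx]; last by exists (fun=> 0) => /nx.
  have [y hy] := flow_exists C0 dV bC tC dl0 r0 dlr mu1 mu2 hx.
  by exists y.
have [Y hY] := choice exY.
have [u [su du]] := flow_potential C0 dV bC tC dl0 r0 dlr mu1 hY.
exists [set x | `|x - p| < dl], u; split => //.
- by apply: open_norm_lt => x; apply: (@continuousB _ _ _ _ (fun x : X => p));
    [exact: cvg_id|exact: cst_continuous].
- by rewrite /= subrr normr0.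
- by move=> x /= hx; apply: dV; apply: lt_trans hx _; lra.
Qed.

End Frobenius.

(** * Frobenius' theorem for an arbitrary integrable 1-form *)

Section FrobeniusForm.
Variables (R : realType) (n : nat).
Local Notation X := 'rV[R]_n.+1.

(** The vanishing of all components of [w /\ dw]. *)
Definition integrable_form (V : set X) (w : 'I_n.+1 -> X -> R) := forall x, V x -> forall i j k,
  w i x * (partial j (w k) x - partial k (w j) x) +
  w j x * (partial k (w i) x - partial i (w k) x) +
  w k x * (partial i (w j) x - partial j (w i) x) = 0.

(** Where [w e] does not vanish, the form can be divided by it: [w /\ dw] merely scales by the
    square of the factor. The components having [e] among their indices become the normalized
    condition, and the factor is absorbed into [c]. *)
Theorem frobenius (V : set X) (p : X) (w : 'I_n.+1 -> X -> R) e :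
  open V -> V p -> (forall j, smooth V (w j)) -> integrable_form V w -> w e p != 0 ->
  exists (W : set X) (u : X -> R),
  [/\ open W, W p, W `<=` V, smooth W u &
    forall x, W x -> exists2 c, c != 0 & forall i, partial i u x = c * w i x].
Proof.
move=> oV Vp sw iw wp.
pose V' := V `&` [set x | w e x != 0].
have V'V : V' `<=` V by move=> x [].
have oV' : open V'.
  rewrite openE => x [Vx wx].
  have n1 : nbhs x V by exact: open_nbhs_nbhs.
  have nx : 0 < `|w e x| by rewrite normr_gt0.
  have n2 := cvg_dist_lt (Cdiff_continuous (sw e 0%N) Vx) nx.
  apply: filterS2 n1 n2 => y Vy; rewrite /= => h; split=> //=.
  by apply: contraTneq h => ->; rewrite sub0r normrN ltxx.
have V'p : V' p by [].
have sw' j k : Cdiff k V' (w j) by exact: Cdiff_subset (sw j k).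
pose th j x := w j x * (w e x)^-1.
have sth j : smooth V' (th j).
  by move=> k; apply: CdiffM => //; apply: CdiffV => // x [].
have dth x i j : V' x ->
    partial i (th j) x = (partial i (w j) x * w e x - w j x * partial i (w e) x) / w e x ^+ 2.
  move=> [Vx wx]; have dw l : derivable (w l) x (delta_mx 0 i).
    by apply: diff_derivable; case: (sw l 1%N) => + _; exact.
  rewrite /partial /th (deriveM (dw j) (derivableV wx (dw e))) (deriveV wx (dw e)).
  rewrite -/(partial i (w j) x) -/(partial i (w e) x) /GRing.scale/=.
  move: (partial _ (w j) _) (partial _ (w e) _) => a b; field.
  exact: wx.
have [|W [u [oW Wp WV su du]]] := @first_integral_normalized R n V' p e th oV' V'p sth.
  move=> x V'x j k; rewrite !dth//; have wx : w e x != 0 by case: V'x.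
  have := iw x (V'V _ V'x) e j k.
  set a := partial j (w k) x; set b := partial k (w j) x; set c := partial k (w e) x.
  set f := partial e (w k) x; set g := partial e (w j) x; set h := partial j (w e) x.
  move=> E; rewrite /th; apply/eqP; rewrite -subr_eq0.
  have -> : (a * w e x - w k x * h) / w e x ^+ 2 - (b * w e x - w j x * c) / w e x ^+ 2 -
    (w j x / w e x * ((f * w e x - w k x * partial e (w e) x) / w e x ^+ 2) -
     w k x / w e x * ((g * w e x - w j x * partial e (w e) x) / w e x ^+ 2)) =
    (w e x * (a - b) + w j x * (c - f) + w k x * (g - h)) / w e x ^+ 2 by field.
  by rewrite E mul0r.
exists W, u; split=> //; first by move=> x /WV/V'V.
move=> x Wx; have [c c0 hc] := du x Wx; have [_ wx] := WV x Wx.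
exists (c / w e x) => [|i]; first by rewrite mulf_neq0 ?invr_neq0// gt_eqF.
by rewrite hc /th mulrA mulrAC.
Qed.

End FrobeniusForm.

(** * Covectors and Cauchy data in dimension three *)

Section Covectors.
Variable R : realType.
Local Notation X := 'rV[R]_3.

Lemma ord3P (P : 'I_3 -> Prop) : P i1 -> P i2 -> P i3 -> forall j, P j.
Proof.
move=> p1 p2 p3 [[|[|[|//]]] h].
- by rewrite (_ : Ordinal h = i1)//; exact: val_inj.
- by rewrite (_ : Ordinal h = i2)//; exact: val_inj.
- by rewrite (_ : Ordinal h = i3)//; exact: val_inj.
Qed.

Lemma sum3 (V : nmodType) (F : 'I_3 -> V) : \sum_i F i = F i1 + (F i2 + F i3).
Proof.
rewrite !big_ord_recl big_ord0 addr0; congr (F _ + (F _ + F _)); exact: val_inj.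
Qed.

Lemma sum2 (V : nmodType) (F : 'I_2 -> V) : \sum_i F i = F j1 + F j2.
Proof.
rewrite !big_ord_recl big_ord0 addr0; congr (F _ + F _); exact: val_inj.
Qed.

Lemma free3P (F : fieldType) (vT : vectType F) (u v w : vT) :
  (forall a b c, a *: u + b *: v + c *: w = 0 -> [/\ a = 0, b = 0 & c = 0]) <->
  free [:: u; v; w].
Proof.
split=> [H|/freeP H a b c E].
  apply/(@freeP _ _ 3 [tuple of [:: u; v; w]]) => k.
  rewrite sum3 /= addrA => /H [k1 k2 k3] i.
  by move: i; apply: ord3P.
have {}H := H (fun i => [:: a; b; c]`_i); rewrite sum3/= addrA in H.
have {}H := H E; split; [exact: (H i1)|exact: (H i2)|exact: (H i3)].
Qed.

Lemma pairing_delta (w : X) j : pairing w (delta_mx 0 j) = w 0 j.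
Proof.
rewrite /pairing (bigD1 j)//= !mxE !eqxx mulr1 big1 ?addr0// => i /negPf ij.
by rewrite mxE ij andbF mulr0.
Qed.

Lemma pairingDr (w u v : X) : pairing w (u + v) = pairing w u + pairing w v.
Proof. by rewrite /pairing -big_split; apply: eq_bigr => i _; rewrite mxE mulrDr. Qed.

Lemma pairingZr (w v : X) c : pairing w (c *: v) = c * pairing w v.
Proof. by rewrite /pairing mulr_sumr; apply: eq_bigr => i _; rewrite mxE mulrCA. Qed.

Lemma pairingZl (w v : X) c : pairing (c *: w) v = c * pairing w v.
Proof. by rewrite /pairing mulr_sumr; apply: eq_bigr => i _; rewrite mxE mulrA. Qed.

Lemma conormal_form_ker (w : X) : conormal (form_ker w) = line w.
Proof.
apply/seteqP; split=> [w' hw'|_ [c _ <-] v hv]; last first.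
  by rewrite pairingZl hv mulr0.
have [w0|] := eqVneq w 0.
  exists 0 => //; rewrite scale0r; apply/rowP => j; rewrite mxE -pairing_delta hw'//.
  by rewrite /form_ker/= w0 /pairing big1// => i _; rewrite mxE mul0r.
move=> /rV0Pn[e we]; exists (w' 0 e / w 0 e) => //; apply/rowP => j.
(* [w'] is tested on the vector [w_e e_j - w_j e_e], which lies in the kernel of [w]. *)
have H : w 0 e * w' 0 j - w 0 j * w' 0 e = 0.
  rewrite -mulNr -!(pairing_delta w') -!pairingZr -pairingDr hw'//.
  by rewrite /form_ker/= pairingDr !pairingZr !pairing_delta mulNr mulrC subrr.
rewrite mxE; apply: (mulfI we); transitivity (w 0 j * w' 0 e); [by field|lra].
Qed.

Lemma codim1_foliation_form (U : set X) (w : X -> X) : open U -> smooth_row U w ->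
  integrable_form U (fun j x => w x 0 j) -> (forall x, U x -> w x != 0) ->
  codim1_foliation U (fun x => form_ker (w x)).
Proof.
move=> oU sw iw w0 p Up; have /rV0Pn[e wp] := w0 p Up.
have [W [u [oW Wp WU su du]]] := frobenius oU Up sw iw wp.
exists W, u; split=> // x Wx; have [c c0 hc] := du x Wx.
have dux : differentiable u x by case: (su 1%N) => + _; exact.
have E v : 'd u x v = c * pairing (w x) v.
  rewrite -deriveE// derive_rV// /pairing mulr_sumr; apply: eq_bigr => i _.
  by rewrite hc mulrC mulrA.
split.
  have /rV0Pn[j wj] := w0 x (WU _ Wx).
  by exists (delta_mx 0 j); rewrite E pairing_delta mulf_neq0.
apply/seteqP; split=> v; rewrite /form_ker/= E; first by move->; rewrite mulr0.
by move=> /eqP; rewrite mulf_eq0 (negPf c0) => /eqP.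
Qed.

(** The components of [w /\ dw] alternate in their three indices, so in dimension three a single one
    determines all. *)
Lemma integrable_form3 (U : set X) (w : 'I_3 -> X -> R) :
  (forall x, U x ->
    w i1 x * (partial i2 (w i3) x - partial i3 (w i2) x) +
    w i2 x * (partial i3 (w i1) x - partial i1 (w i3) x) +
    w i3 x * (partial i1 (w i2) x - partial i2 (w i1) x) = 0) -> integrable_form U w.
Proof.
move=> H x Ux; have := H x Ux => {H}.
move E : (fun i j => partial i (w j) x) => d.
have dE i j : partial i (w j) x = d i j by rewrite -E.
rewrite !dE => H i j k; rewrite !dE; move: i j k.
by do 3!apply: ord3P; lra.
Qed.

(** Symmetry of second derivatives, that is d(df) = 0. It serves the parameter oo. *)
Lemma exact_form_integrable (U : set X) f : open U -> smooth U f ->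
  integrable_form U (fun j => partial j f).
Proof.
move=> oU sf; apply: integrable_form3 => x Ux.
have C i j := partial_comm i j oU Ux (sf 3%N).
have alg (a b c u v q : R) : a * (u - u) + b * (v - v) + c * (q - q) = 0 by ring.
rewrite (C i3 i2) (C i1 i3) (C i2 i1); exact: alg.
Qed.

End Covectors.

(** * Cauchy data and generic jets *)

Section CauchyData.
Variable R : realType.
Local Notation X := 'rV[R]_3.
Local Notation jet := (R * 'rV[R]_2 * R)%type.

(** The part of the jet that determines [df]: its values on the two tangent vectors of the surface
    and on [nu]. *)
Definition jet_row (t : jet) : X := \row_k [:: t.1.2 0 j1; t.1.2 0 j2; t.2]`_k.

Definition Cauchy_frame (s nu : 'rV[R]_2 -> X) (y : 'rV[R]_2) : 'M[R]_3 :=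
  \matrix_(k, i) [:: partial j1 s y 0 i; partial j2 s y 0 i; nu y 0 i]`_k.

Lemma Cauchy_frame_unit Y s nu y : Cauchy_surface Y s nu -> Y y ->
  Cauchy_frame s nu y \in unitmx.
Proof.
case=> _ _ _ fr Yy; rewrite -row_free_unit; apply: inj_row_free => v vM.
have [|a0 b0 c0] := (free3P _ _ _).2 (fr y Yy) (v 0 i1) (v 0 i2) (v 0 i3).
  apply/rowP => i; have /rowP/(_ i) := vM.
  by rewrite !mxE sum3 !mxE/= addrA.
by apply/rowP; apply: ord3P; rewrite mxE.
Qed.

Lemma Cauchy_jet_row Y s nu y (V : set X) f : Cauchy_surface Y s nu -> Y y -> V (s y) ->
  smooth V f ->
  jet_row (Cauchy_jet s nu f y) =
    (\row_i partial i f (s y)) *m (Cauchy_frame s nu y)^T.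
Proof.
move=> [oY ss _ _] Yy Vy sf.
have df : differentiable f (s y) by case: (sf 1%N) => + _; exact.
have ds j : differentiable (fun x => s x 0 j) y by case: (ss j 1%N) => + _; exact.
have dsy v : derivable s y v by apply: diff_derivable; exact: differentiable_rV.
have tang j : partial j (f \o s) y = \sum_i partial i f (s y) * partial j s y 0 i.
  rewrite /partial derive_comp_rV//; apply: eq_bigr => i _.
  by rewrite derive_mx// mxE.
apply/rowP; apply: ord3P; rewrite !mxE /Cauchy_jet/= ?mxE ?tang ?derive_rV//.
- by apply: eq_bigr => i _; rewrite !mxE.
- by apply: eq_bigr => i _; rewrite !mxE.
- by apply: eq_bigr => i _; rewrite !mxE mulrC.
Qed.

(** The excluded jets form three hyperplanes, since no column of the invertible [N] vanishes. *)
Lemma generic_jets (N : 'M[R]_3) : N \in unitmx ->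
  generic_set [set t : jet | forall i, (jet_row t *m N) 0 i != 0].
Proof.
move=> uN.
pose F i (t : jet) := (jet_row t *m N) 0 i.
have FE i t : F i t = t.1.2 0 j1 * N i1 i + (t.1.2 0 j2 * N i2 i + t.2 * N i3 i).
  by rewrite /F mxE sum3 !mxE.
have cF i : continuous (F i).
  move=> t; have -> : F i = (fun t => t.1.2 0 j1 * N i1 i + (t.1.2 0 j2 * N i2 i + t.2 * N i3 i)).
    by apply/funext => u; rewrite FE.
  have cj j : {for t, continuous (fun t : jet => t.1.2 0 j)}.
    apply: (@continuous_comp _ _ _ (fun t : jet => t.1.2) (fun v : 'rV[R]_2 => v 0 j)).
      apply: (@continuous_comp _ _ _ (fun t : jet => t.1) snd); first exact: cvg_fst.
      exact: cvg_snd.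
    exact: coord_continuous.
  have c2 : {for t, continuous (fun t : jet => t.2)} by exact: cvg_snd.
  have cM (g : jet -> R) c : {for t, continuous g} -> {for t, continuous (fun t => g t * c)}.
    by move=> cg; apply: (@continuousM _ _ _ (fun=> c)) => //; exact: cst_continuous.
  apply: (@continuousD _ _ _ (fun t : jet => t.1.2 0 j1 * N i1 i)); first exact: cM.
  by apply: (@continuousD _ _ _ (fun t : jet => t.1.2 0 j2 * N i2 i)); exact: cM.
split.
  rewrite openE => t ht; apply: near_all => i.
  have := cvg_dist_lt (cF i t); rewrite -/(F i t).
  move=> /(_ `|F i t|); rewrite normr_gt0 => /(_ (ht i)).
  apply: filterS => u h; apply: contraTneq h => e.
  by rewrite /F e sub0r normrN ltxx.
move=> O [t Ot] oO.
(* Invertibility of [N] provides one direction along which all three linear forms grow at unit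
   speed; a small positive displacement in it leaves all three hyperplanes. *)
have [q qN] : exists q : X, forall i, (q *m N) 0 i = 1.
  by exists (const_mx 1 *m invmx N) => i; rewrite mulmxKV// mxE.
pose w : 'rV[R]_2 := \row_j q 0 (lift ord_max j).
pose v : jet := (0, w, q 0 i3); pose phi (h : R) : jet := t + h *: v.
have Fphi i h : F i (phi h) = F i t + h.
  have p2 : (phi h).1.2 = t.1.2 + h *: w by [].
  have p3 : (phi h).2 = t.2 + h * q 0 i3 by [].
  have := qN i; rewrite mxE sum3 !FE p2 p3 !mxE => E.
  rewrite (_ : lift ord_max j1 = i1); last exact: val_inj.
  rewrite (_ : lift ord_max j2 = i2); last exact: val_inj.
  by rewrite -[h in RHS]mulr1 -E; ring.
have cphi : {for 0, continuous phi}.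
  by apply: cvgD; [exact: cvg_cst|apply: cvgZr_tmp; exact: cvg_id].
have phi0 : phi 0 = t.
  by rewrite /phi scale0r addr0.
have n1 : \forall h \near (0 : R), O (phi h).
  by apply: cphi; rewrite phi0; exact: open_nbhs_nbhs.
have [eps eps0 heps] := (nbhs_ballP _ _).1 n1.
(* For [0 < h < b i] the value [F i t + h] is not 0; when [F i t = 0] any positive bound does, here
   1. *)
pose b i := if F i t == 0 then 1 else `|F i t|.
have b0 i : 0 < b i by rewrite /b; case: eqVneq => // h; rewrite normr_gt0.
pose h := Num.min eps (Num.min (b i1) (Num.min (b i2) (b i3))) / 2.
have h0 : 0 < h by rewrite divr_gt0// !lt_min eps0 !b0.
have hb : h < eps /\ forall i, h < b i.
  rewrite /h; set m := Num.min eps _.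
  have m0 : 0 < m by rewrite !lt_min eps0 !b0.
  have hm : m / 2 < m by lra.
  split=> [|i]; apply: lt_le_trans hm _; first by rewrite ge_min lexx.
  by move: i; apply: ord3P; rewrite /m !ge_min lexx ?orbT.
exists (phi h); split.
  by apply: heps; rewrite -ball_normE/= sub0r normrN gtr0_norm//; case: hb.
move=> i; rewrite -/(F i (phi h)) Fphi.
have := hb.2 i; rewrite /b; case: eqVneq => [->|_ hi]; first by rewrite add0r gt_eqF.
apply: contraTneq hi => /eqP; rewrite addr_eq0 => /eqP ->.
by rewrite normrN gtr0_norm// ltxx.
Qed.

End CauchyData.

(** * The pencils of the four equations *)

Section Gradients.
Variables (R : realType) (n : nat).
Local Notation X := 'rV[R]_n.+1.
Implicit Types (g : X -> R) (d : 'I_n.+1 -> R).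

(** A relation, so that gradients of compound expressions are assembled by rules, with [d] left to
    unification. *)
Definition has_grad g x d := forall i, is_derive x (delta_mx 0 i) g (d i).

Lemma has_grad_partial g x d : has_grad g x d -> forall i, partial i g x = d i.
Proof. by move=> h i; have [_ <-] := h i. Qed.

Lemma has_grad_smooth (U : set X) g x : smooth U g -> U x ->
  has_grad g x (fun i => partial i g x).
Proof.
move=> sg Ux i; apply/derivableP/diff_derivable.
by case: (sg 1%N) => + _; exact.
Qed.

Lemma has_grad_cst x c : has_grad (fun=> c) x (fun=> 0).
Proof. by move=> i; exact: is_derive_cst. Qed.

Lemma has_gradD f g x df dg : has_grad f x df -> has_grad g x dg ->
  has_grad (fun y => f y + g y) x (fun i => df i + dg i).
Proof. by move=> hf hg i; exact: is_deriveD (hf i) (hg i). Qed.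

Lemma has_gradB f g x df dg : has_grad f x df -> has_grad g x dg ->
  has_grad (fun y => f y - g y) x (fun i => df i - dg i).
Proof. by move=> hf hg i; exact: is_deriveB (hf i) (hg i). Qed.

Lemma has_gradM f g x df dg : has_grad f x df -> has_grad g x dg ->
  has_grad (fun y => f y * g y) x (fun i => f x * dg i + g x * df i).
Proof. by move=> hf hg i; exact: is_deriveM (hf i) (hg i). Qed.

Lemma has_grad_coord x j : has_grad (fun y => y 0 j) x (fun i => (i == j)%:R).
Proof.
move=> i; apply: is_derive_dist => eps e0; exists 1 => // h _.
have -> : (h *: delta_mx 0 i + x) 0 j - x 0 j - h * (i == j)%:R = 0.
  by rewrite !mxE eqxx/= eq_sym addrK subrr.
by rewrite normr0 mulr_ge0// ltW.
Qed.

Lemma has_grad_comp1 (l : R -> R) g x d : derivable l (g x) 1 -> has_grad g x d ->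
  has_grad (fun y => l (g y)) x (fun i => derive1 l (g x) * d i).
Proof.
move=> dl hg i; have dg := hg i.
have dlg : is_derive (g x) (1 : R) l (derive1 l (g x)) by rewrite derive1E; exact: derivableP.
pose k (h : R) := g (h *: delta_mx 0 i + x).
have dk : is_derive (0 : R) (1 : R) k (d i).
  have := @is_derive_line R X R g x (delta_mx 0 i) 0.
  by rewrite scale0r add0r => /(_ _)[]; case: dg => // ? <- ? ?; split.
have k0 : k 0 = g x by rewrite /k scale0r add0r.
have dlk : is_derive (0 : R) (1 : R) (l \o k) (derive1 l (g x) * d i).
  by rewrite -k0 in dlg *; exact: (is_derive1_comp dlg dk).
by apply: is_derive_of_line dlk => h; rewrite addr0.
Qed.

Lemma smooth_partial (U : set X) g i : smooth U g -> smooth U (partial i g).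
Proof. by move=> sg k; case: (sg k.+1) => _ /(_ i). Qed.

End Gradients.

Section Pencils.
Variable R : realType.
Local Notation X := 'rV[R]_3.

(* Row [j] lists the coefficients of [lambda^0, lambda^1, lambda^2] in the [dx_(j+1)]-component. *)
Definition pencil_coefs (E : web_pde R) (f : X -> R) (x : X) : seq (seq R) :=
  let f1 := partial i1 f x in
  let f2 := partial i2 f x in
  let f3 := partial i3 f x in
  match E with
  | EqA l1 l2 l3 =>
    let l1 := l1 (x 0 i1) in let l2 := l2 (x 0 i2) in let l3 := l3 (x 0 i3) in
    [:: [:: l2 * l3 * f1; - (l2 + l3) * f1; f1];
        [:: l3 * l1 * f2; - (l3 + l1) * f2; f2];
        [:: l1 * l2 * f3; - (l1 + l2) * f3; f3]]
  | EqB l2 l3 =>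
    let l2 := l2 (x 0 i2) in let l3 := l3 (x 0 i3) in
    [:: [:: l2 * l3 * f1; - (l2 + l3) * f1; f1];
        [:: l2 * l3 * f2 - l3 * f1; - (l2 + l3) * f2 + f1; f2];
        [:: l2 * l2 * f3; - (l2 + l2) * f3; f3]]
  | EqC l3 =>
    let e := expR (derive1 l3 (x 0 i3) * x 0 i2) in let l3 := l3 (x 0 i3) in
    [:: [:: l3 * l3 * f1; - (l3 + l3) * f1; f1];
        [:: l3 * l3 * f2 - l3 * (e * f1); - (l3 + l3) * f2 + e * f1; f2];
        [:: l3 * l3 * f3 - l3 * f2 + e * f1; - (l3 + l3) * f3 + f2; f3]]
  | EqD a b l3 =>
    let a := a (x12 x) in let b := b (x12 x) in let l3 := l3 (x 0 i3) in
    [:: [:: l3 * (a * f1 - b * f2); - (a * f1 - b * f2) - l3 * f1; f1];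
        [:: l3 * (a * f2 + b * f1); - (a * f2 + b * f1) - l3 * f2; f2];
        [:: (a * a + b * b) * f3; - (a + a) * f3; f3]]
  end.

Lemma Poly3 (a b c : R) : Poly [:: a; b; c] = a%:P + b%:P * 'X + c%:P * 'X ^+ 2.
Proof. by rewrite /= !cons_poly_def; ring. Qed.

Lemma horner_Poly3 (a b c l : R) : (Poly [:: a; b; c]).[l] = a + l * b + l ^+ 2 * c.
Proof. by rewrite horner_Poly /=; ring. Qed.

Lemma i3_eqE : ((i1 == i1) = true) * ((i1 == i2) = false) * ((i1 == i3) = false) *
  ((i2 == i1) = false) * ((i2 == i2) = true) * ((i2 == i3) = false) *
  ((i3 == i1) = false) * ((i3 == i2) = false) * ((i3 == i3) = true).
Proof. by []. Qed.

Lemma alpha_pencilE E f x (j : 'I_3) :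
  alpha_pencil E f x 0 j = Poly (nth [::] (pencil_coefs E f x) j).
Proof.
move: j; apply: ord3P; case: E => [l1 l2 l3|l2 l3|l3|a b l3];
  rewrite /pencil_coefs /alpha_pencil;
  move: (partial i1 f x) (partial i2 f x) (partial i3 f x) => f1 f2 f3;
  rewrite [nth _ _ _]/= Poly3 !mxE !i3_eqE !eqxx ![_ && _]/= ?(mulr1, mulr0, addr0, add0r, subr0);
  ring.
Qed.

Lemma alpha_coefE (E : web_pde R) f k x (j : 'I_3) :
  alpha_coef E f k x 0 j = nth 0 (nth [::] (pencil_coefs E f x) j) k.
Proof. by rewrite mxE alpha_pencilE coef_Poly. Qed.

Lemma alphaE (E : web_pde R) f l x :
  alpha E f l x = alpha_coef E f 0 x + l *: alpha_coef E f 1 x + l ^+ 2 *: alpha_coef E f 2 x.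
Proof.
apply/rowP => j; rewrite !mxE alpha_pencilE !coef_Poly; move: j.
by apply: ord3P; case: E => *; exact: horner_Poly3.
Qed.

Lemma alpha_entry (E : web_pde R) f l x (j : 'I_3) :
  let c k := nth 0 (nth [::] (pencil_coefs E f x) j) k in
  alpha E f l x 0 j = c 0%N + l * c 1%N + l ^+ 2 * c 2%N.
Proof.
have H (u v w : X) : (u + l *: v + l ^+ 2 *: w) 0 j = u 0 j + l * v 0 j + l ^+ 2 * w 0 j.
  by rewrite !mxE.
by rewrite alphaE H !alpha_coefE.
Qed.

(** For every equation the leading coefficient is [df], so the foliation at oo consists of level
    sets of [f]. *)
Lemma alpha_coef2 (E : web_pde R) f x : alpha_coef E f 2 x = \row_j partial j f x.
Proof.
by apply/rowP => j; rewrite alpha_coefE mxE; move: j; apply: ord3P; case: E.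
Qed.

Section Smoothness.
Variables (W U : set X) (f : X -> R).
Hypotheses (oU : open U) (UW : U `<=` W) (sf : smooth U f).

Lemma coord_image_in i x : U x -> coord_image i W (x 0 i).
Proof. by move=> /UW Wx; exists x. Qed.

Lemma smooth_coord_comp i l : smooth1 (coord_image i W) l -> smooth U (fun x => l (x 0 i)).
Proof.
move=> sl k; apply: smooth1_comp_Cdiff oU sl _ (Cdiff_coord k U i) => x.
exact: coord_image_in.
Qed.

Lemma x12_coord (y : X) j : x12 y 0 j = y 0 (lift ord_max j).
Proof. by rewrite mxE. Qed.

Lemma smooth_x12_comp (a : 'rV[R]_2 -> R) : smooth (@x12 R @` W) a ->
  smooth U (fun x => a (x12 x)).
Proof.
move=> sa k; apply: Cdiff_comp (sa k) => //; first by move=> x /UW Wx; exists x.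
move=> j; apply: Cdiff_eq (Cdiff_coord k U (lift ord_max j)) => // x _.
by rewrite x12_coord.
Qed.

Lemma smooth1_derive I (l : R -> R) : smooth1 I l -> smooth1 I (derive1 l).
Proof. by move=> sl k t It; have := sl k.+1 t It; rewrite derive1Sn. Qed.

Lemma alpha_coef_smooth E k : admissible W E -> (k < 3)%N -> smooth_row U (alpha_coef E f k).
Proof.
move=> adm k3 j m.
apply: Cdiff_eq (_ : Cdiff m U (fun x => nth 0 (nth [::] (pencil_coefs E f x) j) k)) => //.
  by move=> x _; rewrite alpha_coefE.
have c1 := smooth_partial i1 sf m; have c2 := smooth_partial i2 sf m.
have c3 := smooth_partial i3 sf m.
have K := @CdiffM R 2 m U; have D := @CdiffD R 2 m U; have N := @CdiffN R 2 m U.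
move: j; case: E adm => [l1 l2 l3|l2 l3|l3|a b l3] /= adm.
- case: adm => /smooth_coord_comp/(_ m) s1 /smooth_coord_comp/(_ m) s2 /smooth_coord_comp/(_ m) s3 _.
  by apply: ord3P; case: k k3 => [|[|[|//]]] _ /=; repeat first [assumption|apply K|apply D|apply N].
- case: adm => /smooth_coord_comp/(_ m) s2 /smooth_coord_comp/(_ m) s3 _.
  by apply: ord3P; case: k k3 => [|[|[|//]]] _ /=; repeat first [assumption|apply K|apply D|apply N].
- have s3 := smooth_coord_comp adm m; have s3' := smooth_coord_comp (smooth1_derive adm) m.
  have se : Cdiff m U (fun x => expR (derive1 l3 (x 0 i3) * x 0 i2)).
    by apply: Cdiff_expR => //; apply: K => //; exact: Cdiff_coord.
  by apply: ord3P; case: k k3 => [|[|[|//]]] _ /=; repeat first [assumption|apply K|apply D|apply N].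
- case: adm => /smooth_x12_comp/(_ m) sa /smooth_x12_comp/(_ m) sb /smooth_coord_comp/(_ m) s3 _.
  by apply: ord3P; case: k k3 => [|[|[|//]]] _ /=; repeat first [assumption|apply K|apply D|apply N].
Qed.

Lemma alpha_smooth E l : admissible W E -> smooth_row U (alpha E f l).
Proof.
move=> adm j m; have s k k3 := @alpha_coef_smooth E k adm k3 j m.
apply: Cdiff_eq (_ : Cdiff m U (fun x => alpha_coef E f 0 x 0 j +
    l * alpha_coef E f 1 x 0 j + l ^+ 2 * alpha_coef E f 2 x 0 j)) => //.
  by move=> x _; rewrite alpha_entry !alpha_coefE.
by apply: CdiffD => //; [apply: CdiffD => //; first exact: s|];
  apply: CdiffM => //; first [exact: s|exact: Cdiff_cst].
Qed.

End Smoothness.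

End Pencils.

(** Derivatives at [x] become independent variables, which leaves an algebraic identity. *)
Ltac generalize_partials x :=
  repeat match goal with
  | |- context [partial ?i (partial ?j ?f) x] => generalize (partial i (partial j f) x); intro
  end;
  repeat match goal with |- context [partial ?i ?f x] => generalize (partial i f x); intro end.

Lemma eq0_of_multiple (R : pzRingType) (K a b : R) : b = 0 -> a = K * b -> a = 0.
Proof. by move=> -> ->; rewrite mulr0. Qed.

(** * Integrability of the pencils *)

Section Integrability.
Variable R : realType.
Local Notation X := 'rV[R]_3.
Variables (W U : set X) (f : X -> R) (l : R).
Hypotheses (oU : open U) (UW : U `<=` W) (sf : smooth U f).

Lemma has_grad_coord_comp i (g : R -> R) x : smooth1 (coord_image i W) g -> U x ->
  has_grad (fun y : X => g (y 0 i)) x (fun k => derive1 g (x 0 i) * (k == i)%:R).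
Proof.
move=> sg Ux; apply: has_grad_comp1; last exact: has_grad_coord.
by apply: (sg 0%N); exact: coord_image_in UW _ _ Ux.
Qed.

Lemma has_grad_x12_comp (a : 'rV[R]_2 -> R) x : smooth (@x12 R @` W) a -> U x ->
  has_grad (fun y : X => a (x12 y)) x
    (fun k => partial j1 a (x12 x) * (k == i1)%:R + partial j2 a (x12 x) * (k == i2)%:R).
Proof.
move=> sa Ux k.
have da : differentiable a (x12 x).
  by case: (sa 1%N) => + _; apply; exists x => //; exact: UW.
have E j : (fun y : X => x12 y 0 j) = (fun y => y 0 (lift ord_max j)).
  by apply/funext => y; rewrite x12_coord.
have dx j : differentiable (fun y : X => x12 y 0 j) x.
  by rewrite E; exact: differentiable_coord.
have dc j : partial k (fun y : X => x12 y 0 j) x = (k == lift ord_max j)%:R.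
  by rewrite E; exact: has_grad_partial (has_grad_coord x (lift ord_max j)) k.
split.
  apply: diff_derivable; apply: (@differentiable_comp _ _ _ _ (@x12 R) a) => //.
  exact: differentiable_rV.
have := derive_comp_rV (delta_mx 0 k) dx da; rewrite sum2.
have <- : lift ord_max j1 = i1 by exact: val_inj.
have <- : lift ord_max j2 = i2 by exact: val_inj.
by rewrite -!dc.
Qed.

Let gf i x (Ux : U x) := has_grad_smooth (smooth_partial i sf) Ux.

Let comm i j x (Ux : U x) := partial_comm i j oU Ux (sf 3%N).

(** Components enter in factored form and gradients as data, so that each equation is left with an
    identity at one point. *)
Lemma integrable_of_factors (w : X -> X) (w1 w2 w3 : X -> R) :
  (forall x, w x 0 i1 = w1 x) -> (forall x, w x 0 i2 = w2 x) -> (forall x, w x 0 i3 = w3 x) ->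
  (forall x, U x -> exists d1 d2 d3, [/\ has_grad w1 x d1, has_grad w2 x d2, has_grad w3 x d3 &
    w1 x * (d3 i2 - d2 i3) + w2 x * (d1 i3 - d3 i1) + w3 x * (d2 i1 - d1 i2) = 0]) ->
  integrable_form U (fun j x => w x 0 j).
Proof.
move=> e1 e2 e3 H; apply: integrable_form3 => x /H [d1 [d2 [d3 [g1 g2 g3]]]].
rewrite (funext e1) (funext e2) (funext e3) e1 e2 e3.
by rewrite !(has_grad_partial g1) !(has_grad_partial g2) !(has_grad_partial g3).
Qed.

Lemma integrable_alphaA l1 l2 l3 : admissible W (EqA l1 l2 l3) ->
  (forall x, U x -> pde_holds (EqA l1 l2 l3) f x) ->
  integrable_form U (fun j x => alpha (EqA l1 l2 l3) f l x 0 j).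
Proof.
move=> [s1 s2 s3 _] pde.
apply: (@integrable_of_factors _
  (fun x => (l2 (x 0 i2) - l) * (l3 (x 0 i3) - l) * partial i1 f x)
  (fun x => (l3 (x 0 i3) - l) * (l1 (x 0 i1) - l) * partial i2 f x)
  (fun x => (l1 (x 0 i1) - l) * (l2 (x 0 i2) - l) * partial i3 f x)).
1-3: by move=> x; rewrite alpha_entry /=; ring.
move=> x Ux.
have g1 := has_gradB (has_grad_coord_comp s1 Ux) (has_grad_cst x l).
have g2 := has_gradB (has_grad_coord_comp s2 Ux) (has_grad_cst x l).
have g3 := has_gradB (has_grad_coord_comp s3 Ux) (has_grad_cst x l).
do 3!eexists; split; [exact: has_gradM (has_gradM g2 g3) (gf i1 Ux)
  |exact: has_gradM (has_gradM g3 g1) (gf i2 Ux)|exact: has_gradM (has_gradM g1 g2) (gf i3 Ux)|].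
have := pde x Ux; rewrite /pde_holds.
rewrite !i3_eqE (comm i2 i1 Ux) (comm i1 i3 Ux) (comm i3 i2 Ux) /nat_of_bool.
generalize_partials x.
move: (derive1 l1 _) (derive1 l2 _) (derive1 l3 _) (l1 (x 0 i1)) (l2 (x 0 i2)) (l3 (x 0 i3)).
move=> dc1 dc2 dc3 c1 c2 c3 P.
(* The terms with derivatives of [l1], [l2], [l3] cancel in pairs. *)
by apply: (@eq0_of_multiple R ((c1 - l) * (c2 - l) * (c3 - l)) _ _ P); ring.
Qed.

Lemma integrable_alphaB l2 l3 : admissible W (EqB l2 l3) ->
  (forall x, U x -> pde_holds (EqB l2 l3) f x) ->
  integrable_form U (fun j x => alpha (EqB l2 l3) f l x 0 j).
Proof.
move=> [s2 s3 _] pde.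
apply: (@integrable_of_factors _
  (fun x => (l2 (x 0 i2) - l) * (l3 (x 0 i3) - l) * partial i1 f x)
  (fun x => (l2 (x 0 i2) - l) * (l3 (x 0 i3) - l) * partial i2 f x
            - (l3 (x 0 i3) - l) * partial i1 f x)
  (fun x => (l2 (x 0 i2) - l) * (l2 (x 0 i2) - l) * partial i3 f x)).
1-3: by move=> x; rewrite alpha_entry /=; ring.
move=> x Ux.
have g2 := has_gradB (has_grad_coord_comp s2 Ux) (has_grad_cst x l).
have g3 := has_gradB (has_grad_coord_comp s3 Ux) (has_grad_cst x l).
do 3!eexists; split; [exact: has_gradM (has_gradM g2 g3) (gf i1 Ux)
  |exact: has_gradB (has_gradM (has_gradM g2 g3) (gf i2 Ux)) (has_gradM g3 (gf i1 Ux))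
  |exact: has_gradM (has_gradM g2 g2) (gf i3 Ux)|].
have := pde x Ux; rewrite /pde_holds.
rewrite !i3_eqE (comm i2 i1 Ux) (comm i1 i3 Ux) (comm i3 i2 Ux) /nat_of_bool.
generalize_partials x.
move: (derive1 l2 _) (derive1 l3 _) (l2 (x 0 i2)) (l3 (x 0 i3)) => dc2 dc3 c2 c3 P.
(* The derivative of [l3] cancels; that of [l2] survives as the last term of the equation. *)
by apply: (@eq0_of_multiple R ((c2 - l) * (c2 - l) * (c3 - l)) _ _ P); ring.
Qed.

Lemma integrable_alphaC l3 : admissible W (EqC l3) ->
  (forall x, U x -> pde_holds (EqC l3) f x) ->
  integrable_form U (fun j x => alpha (EqC l3) f l x 0 j).
Proof.
move=> s3 pde.
pose ex (x : X) := expR (derive1 l3 (x 0 i3) * x 0 i2).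
apply: (@integrable_of_factors _
  (fun x => (l3 (x 0 i3) - l) * (l3 (x 0 i3) - l) * partial i1 f x)
  (fun x => (l3 (x 0 i3) - l) * (l3 (x 0 i3) - l) * partial i2 f x
            - (l3 (x 0 i3) - l) * (ex x * partial i1 f x))
  (fun x => (l3 (x 0 i3) - l) * (l3 (x 0 i3) - l) * partial i3 f x
            - (l3 (x 0 i3) - l) * partial i2 f x + ex x * partial i1 f x)).
1-3: by move=> x; rewrite alpha_entry /= -/(ex x); ring.
move=> x Ux.
have g3 := has_gradB (has_grad_coord_comp s3 Ux) (has_grad_cst x l).
have ge : has_grad ex x (fun i => derive1 (@expR R) (derive1 l3 (x 0 i3) * x 0 i2) *
    (derive1 l3 (x 0 i3) * (i == i2)%:R + x 0 i2 * (derive1 (derive1 l3) (x 0 i3) * (i == i3)%:R))).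
  apply: has_grad_comp1; first exact: derivable_expR.
  exact: has_gradM (has_grad_coord_comp (smooth1_derive s3) Ux) (has_grad_coord x i2).
have Eexp t : derive1 (@expR R) t = expR t by rewrite derive1E derive_val.
do 3!eexists; split; [exact: has_gradM (has_gradM g3 g3) (gf i1 Ux)
  |exact: has_gradB (has_gradM (has_gradM g3 g3) (gf i2 Ux)) (has_gradM g3 (has_gradM ge (gf i1 Ux)))
  |exact: has_gradD (has_gradB (has_gradM (has_gradM g3 g3) (gf i3 Ux)) (has_gradM g3 (gf i2 Ux)))
     (has_gradM ge (gf i1 Ux))|].
have := pde x Ux; rewrite /pde_holds /ex expRN !Eexp.
rewrite !i3_eqE (comm i2 i1 Ux) (comm i1 i3 Ux) (comm i3 i2 Ux) /nat_of_bool.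
generalize_partials x.
have : expR (derive1 l3 (x 0 i3) * x 0 i2) != 0 by rewrite gt_eqF// expR_gt0.
rewrite (_ : derive1n 2 l3 = derive1 (derive1 l3))//.
move: (expR (derive1 l3 (x 0 i3) * x 0 i2)) => ee.
move: (derive1 (derive1 l3) _) (derive1 l3 _) (l3 _) (x 0 i2) => ddc3 dc3 c3 x2 e0 P.
(* The factor [ee] clears the inverse exponential in the equation. The second derivative of [l3]
   stems from differentiating [ex] in the third variable. *)
by apply: (@eq0_of_multiple R ((c3 - l) * (c3 - l) * (c3 - l) * ee) _ _ P); field.
Qed.

Lemma integrable_alphaD a b l3 : admissible W (EqD a b l3) ->
  (forall x, U x -> pde_holds (EqD a b l3) f x) ->
  integrable_form U (fun j x => alpha (EqD a b l3) f l x 0 j).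
Proof.
move=> [sa sb s3 CR] pde.
apply: (@integrable_of_factors _
  (fun x => (l3 (x 0 i3) - l) * ((a (x12 x) - l) * partial i1 f x - b (x12 x) * partial i2 f x))
  (fun x => (l3 (x 0 i3) - l) * ((a (x12 x) - l) * partial i2 f x + b (x12 x) * partial i1 f x))
  (fun x => ((a (x12 x) - l) * (a (x12 x) - l) + b (x12 x) * b (x12 x)) * partial i3 f x)).
1-3: by move=> x; rewrite alpha_entry /=; ring.
move=> x Ux.
have g3 := has_gradB (has_grad_coord_comp s3 Ux) (has_grad_cst x l).
have ga := has_gradB (has_grad_x12_comp sa Ux) (has_grad_cst x l).
have gb := has_grad_x12_comp sb Ux.
have [|_ CR1 CR2] := CR (x12 x); first by exists x => //; exact: UW.
(* Harmonic duality trades the derivatives of [a] for those of [b], which then cancel. *)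
rewrite CR1 CR2 in ga.
do 3!eexists; split; [
   exact: has_gradM g3 (has_gradB (has_gradM ga (gf i1 Ux)) (has_gradM gb (gf i2 Ux)))
  |exact: has_gradM g3 (has_gradD (has_gradM ga (gf i2 Ux)) (has_gradM gb (gf i1 Ux)))
  |exact: has_gradM (has_gradD (has_gradM ga ga) (has_gradM gb gb)) (gf i3 Ux)|].
have := pde x Ux; rewrite /pde_holds.
rewrite !i3_eqE (comm i2 i1 Ux) (comm i1 i3 Ux) (comm i3 i2 Ux) /nat_of_bool.
generalize_partials x.
move: (partial j1 b (x12 x)) (partial j2 b (x12 x)) (derive1 l3 _) (l3 (x 0 i3)).
move: (a (x12 x)) (b (x12 x)) => aa bb b1 b2 dc3 c3 P.
by apply: (@eq0_of_multiple R ((c3 - l) * ((aa - l) * (aa - l) + bb * bb)) _ _ P); ring.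
Qed.

Lemma integrable_alpha E : admissible W E -> (forall x, U x -> pde_holds E f x) ->
  integrable_form U (fun j x => alpha E f l x 0 j).
Proof.
case: E => *.
- exact: integrable_alphaA.
- exact: integrable_alphaB.
- exact: integrable_alphaC.
- exact: integrable_alphaD.
Qed.

End Integrability.

(** * Nondegeneracy and the Veronese web *)

Section Nondegeneracy.
Variable R : realType.
Local Notation X := 'rV[R]_3.

(** A relation with coefficients [u], [v], [w] says that the linear functional taking 1, lambda,
    lambda^2 to [u], [v], [w] kills the three components of the pencil. The claim is that these
    components span the quadratic polynomials. *)
Lemma nondegenerate_at (W : set X) (E : web_pde R) (f : X -> R) x : admissible W E -> W x ->
  (forall i, partial i f x != 0) ->
  free [:: alpha_coef E f 0 x; alpha_coef E f 1 x; alpha_coef E f 2 x].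
Proof.
move=> adm Wx fn0; apply/free3P => u v w /rowP H.
have {}H (j : 'I_3) : u * nth 0 (nth [::] (pencil_coefs E f x) j) 0 +
    v * nth 0 (nth [::] (pencil_coefs E f x) j) 1 +
    w * nth 0 (nth [::] (pencil_coefs E f x) j) 2 = 0.
  have G (p q s : X) : (u *: p + v *: q + w *: s) 0 j = u * p 0 j + v * q 0 j + w * s 0 j.
    by rewrite !mxE.
  by have := H j; rewrite G !alpha_coefE mxE.
have f10 := fn0 i1; have f20 := fn0 i2; have f30 := fn0 i3.
have cancel (a b : R) : a != 0 -> a * b = 0 -> b = 0.
  by move=> a0 /eqP; rewrite mulf_eq0 (negPf a0) => /eqP.
have neq (a b : R) : a <> b -> a - b != 0 by move=> ab; rewrite subr_eq0; apply/eqP.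
move: (H i1) (H i2) (H i3) adm => {H}; case: E => [l1 l2 l3|l2 l3|l3|a b l3] /=.
- move=> h1 h2 h3 [_ _ _ /(_ x Wx)[/neq n12 /neq n23 /neq n13]].
  move: (l1 (x 0 i1)) (l2 (x 0 i2)) (l3 (x 0 i3)) n12 n23 n13 h1 h2 h3 => c1 c2 c3 n12 n23 n13.
  move: (partial i1 f x) (partial i2 f x) (partial i3 f x) f10 f20 f30 => f1 f2 f3 f10 f20 f30.
  move=> h1 h2 h3.
  have {}h1 : u * c2 * c3 - v * (c2 + c3) + w = 0 by apply: (cancel f1) => //; lra.
  have {}h2 : u * c3 * c1 - v * (c3 + c1) + w = 0 by apply: (cancel f2) => //; lra.
  have {}h3 : u * c1 * c2 - v * (c1 + c2) + w = 0 by apply: (cancel f3) => //; lra.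
  (* The difference of two of the quadratics is a multiple of the linear factor they share. *)
  have e1 : u * c3 - v = 0 by apply: (cancel (c1 - c2)) => //; lra.
  have e2 : u * c2 - v = 0 by apply: (cancel (c1 - c3)) => //; lra.
  have u0 : u = 0 by apply: (cancel (c2 - c3)) => //; lra.
  have v0 : v = 0 by rewrite u0 in e1; lra.
  by split=> //; rewrite u0 v0 in h1; lra.
- move=> h1 h2 h3 [_ _ /(_ x Wx) /neq n23].
  move: (l2 (x 0 i2)) (l3 (x 0 i3)) n23 h1 h2 h3 => c2 c3 n23.
  move: (partial i1 f x) (partial i2 f x) (partial i3 f x) f10 f20 f30 => f1 f2 f3 f10 f20 f30.
  move=> h1 h2 h3.
  have {}h1 : u * c2 * c3 - v * (c2 + c3) + w = 0 by apply: (cancel f1) => //; lra.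
  have e1 : u * c3 - v = 0.
    apply: (cancel f1) => //.
    have := congr1 ( *%R f2) h1; rewrite mulr0; lra.
  have {}h3 : u * c2 * c2 - v * (c2 + c2) + w = 0 by apply: (cancel f3) => //; lra.
  have e2 : u * c2 - v = 0 by apply: (cancel (c2 - c3)) => //; lra.
  have u0 : u = 0 by apply: (cancel (c2 - c3)) => //; lra.
  have v0 : v = 0 by rewrite u0 in e1; lra.
  by split=> //; rewrite u0 v0 in h1; lra.
- move=> h1 h2 h3 _.
  have e0 : expR (derive1 l3 (x 0 i3) * x 0 i2) != 0 by rewrite gt_eqF// expR_gt0.
  move: (expR _) e0 (l3 (x 0 i3)) h1 h2 h3 => ee e0 c3.
  move: (partial i1 f x) (partial i2 f x) (partial i3 f x) f10 f20 f30 => f1 f2 f3 f10 f20 f30.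
  move=> h1 h2 h3.
  have {}h1 : u * c3 * c3 - v * (c3 + c3) + w = 0 by apply: (cancel f1) => //; lra.
  have e1 : u * c3 - v = 0.
    apply: (cancel f1) => //; apply: (cancel ee) => //.
    have := congr1 ( *%R f2) h1; rewrite mulr0; lra.
  have u0 : u = 0.
    apply: (cancel f1) => //; apply: (cancel ee) => //.
    have := congr1 ( *%R f3) h1; have := congr1 ( *%R f2) e1; rewrite !mulr0; lra.
  have v0 : v = 0 by rewrite u0 in e1; lra.
  by split=> //; rewrite u0 v0 in h1; lra.
- move=> h1 h2 h3 [_ _ _ CR]; have [|/eqP b0 _ _] := CR (x12 x); first by exists x.
  move: (a (x12 x)) (b (x12 x)) b0 (l3 (x 0 i3)) h1 h2 h3 => aa bb b0 c3.
  move: (partial i1 f x) (partial i2 f x) (partial i3 f x) f10 f20 f30 => f1 f2 f3 f10 f20 f30.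
  move=> h1 h2 h3.
  have f12 : f1 ^+ 2 + f2 ^+ 2 != 0.
    by rewrite gt_eqF// ltr_pwDl ?exprn_even_gt0// sqr_ge0.
  (* With [S], [T] the left-hand sides of [S0], [T0], the first two relations are
     [f1 S - b f2 T = 0] and [f2 S + b f1 T = 0], a linear system of determinant
     [b (f1^2 + f2^2)]. *)
  have S0 : u * c3 * aa - v * (aa + c3) + w = 0.
    apply: (cancel (f1 ^+ 2 + f2 ^+ 2)) => //.
    have := congr1 ( *%R f1) h1; have := congr1 ( *%R f2) h2; rewrite !mulr0; lra.
  have T0 : u * c3 - v = 0.
    apply: (cancel f1) => //; apply: (cancel bb) => //.
    have := congr1 ( *%R f2) S0; rewrite mulr0; lra.
  have {}h3 : u * (aa * aa + bb * bb) - v * (aa + aa) + w = 0 by apply: (cancel f3) => //; lra.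
  (* The value at [l3] of the quadratic with roots [a + ib] and [a - ib]. *)
  have ab0 : (aa - c3) ^+ 2 + bb ^+ 2 != 0.
    by rewrite gt_eqF// ltr_wpDl ?exprn_even_gt0// sqr_ge0.
  have u0 : u = 0.
    apply: (cancel ((aa - c3) ^+ 2 + bb ^+ 2)) => //.
    have := congr1 ( *%R aa) T0; have := congr1 ( *%R c3) T0; rewrite !mulr0; lra.
  have v0 : v = 0 by rewrite u0 in T0; lra.
  by split=> //; rewrite u0 v0 in S0; lra.
Qed.

Lemma alpha_neq0 (E : web_pde R) (f : X -> R) l x :
  free [:: alpha_coef E f 0 x; alpha_coef E f 1 x; alpha_coef E f 2 x] -> alpha E f l x != 0.
Proof.
move=> /free3P fr; apply/eqP => a0.
have [|u0 _ _] := fr 1 l (l ^+ 2); first by rewrite scale1r -alphaE.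
by move/eqP: u0; rewrite oner_eq0.
Qed.

Lemma alpha_coef2_neq0 (E : web_pde R) (f : X -> R) x :
  free [:: alpha_coef E f 0 x; alpha_coef E f 1 x; alpha_coef E f 2 x] -> alpha_coef E f 2 x != 0.
Proof.
move=> /free3P fr; apply/eqP => a0.
have [|_ _ u0] := fr 0 0 1; first by rewrite a0 !scale0r scaler0 !addr0.
by move/eqP: u0; rewrite oner_eq0.
Qed.

(** [J] collects the jets whose reconstructed gradient has no zero component; it depends only on the
    frame of the surface at [y]. By continuity the gradient keeps this property near [s y]. *)
Lemma generic_nondegenerate (W : set X) (E : web_pde R) (s nu : 'rV[R]_2 -> X) Y y :
  admissible W E -> Cauchy_surface Y s nu -> Y y ->
  exists J : set (R * 'rV[R]_2 * R), generic_set J /\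
    forall (V : set X) (f : X -> R),
      open V -> V (s y) -> V `<=` W -> solution V E f -> J (Cauchy_jet s nu f y) ->
      exists U : set X, [/\ open U, U (s y), U `<=` V & nondegenerate_sol U E f].
Proof.
move=> adm CS Yy; have uM := Cauchy_frame_unit CS Yy.
have uN : invmx (Cauchy_frame s nu y)^T \in unitmx by rewrite unitmx_inv unitmx_tr.
exists [set t | forall i, (jet_row t *m invmx (Cauchy_frame s nu y)^T) 0 i != 0].
split=> [|V f oV Vy VW [sf _] /= Jt]; first exact: generic_jets.
have fy i : partial i f (s y) != 0.
  have := Jt i; rewrite (Cauchy_jet_row CS Yy Vy sf) mulmxK ?unitmx_tr//.
  by rewrite mxE.
exists (V `&` [set x | forall i, partial i f x != 0]); split=> //.
- rewrite openE => x [Vx fx].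
  have n1 : nbhs x V by exact: open_nbhs_nbhs.
  have n2 : nbhs x [set x' | forall i, partial i f x' != 0].
    apply: near_all => i; have px : 0 < `|partial i f x| by rewrite normr_gt0.
    have := cvg_dist_lt (Cdiff_continuous (smooth_partial i sf 0%N) Vx) px.
    apply: filterS => z h; apply: contraTneq h => ->.
    by rewrite sub0r normrN ltxx.
  by apply: filterS2 n1 n2 => z ? ?.
- by move=> x [Vx fx]; apply: (nondegenerate_at adm) => //; exact: VW.
Qed.

Lemma solution_Veronese_web (W U : set X) (E : web_pde R) (f : X -> R) : admissible W E ->
  open U -> U `<=` W -> solution U E f -> nondegenerate_sol U E f ->
  Veronese_web U (web_distribution E f).
Proof.
move=> adm oU UW [sf pde] nd; split=> [[l|]|p Up].
- apply: codim1_foliation_form => //.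
  + exact: alpha_smooth oU UW sf _ _ adm.
  + exact: integrable_alpha oU UW sf _ adm pde.
  + by move=> x /nd/alpha_neq0.
- apply: codim1_foliation_form => //.
  + by apply: alpha_coef_smooth oU UW sf _ _ adm _.
  + have -> : (fun j x => alpha_coef E f 2 x 0 j) = (fun j => partial j f).
      by apply/funext => j; apply/funext => x; rewrite alpha_coef2 mxE.
    exact: exact_form_integrable.
  + by move=> x /nd/alpha_coef2_neq0.
(* The coefficients of the pencil form a coframe on all of [U], which serves every point. *)
exists U, (alpha_coef E f 0), (alpha_coef E f 1), (alpha_coef E f 2); split=> //.
  by split; [apply: alpha_coef_smooth oU UW sf _ _ adm _..|exact: nd].
move=> x Ux; split=> [l|]; last exact: conormal_form_ker.
by rewrite -alphaE; exact: conormal_form_ker.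
Qed.

End Nondegeneracy.

Theorem mainTheorem4 (R : realType) (W : set 'rV[R]_3) (E : web_pde R)
    (W_open : open W) (E_adm : admissible W E) :
  (forall (Y : set 'rV[R]_2) (s nu : 'rV[R]_2 -> 'rV[R]_3) (y : 'rV[R]_2),
     Cauchy_surface Y s nu -> Y y -> W (s y) ->
     exists J : set (R * 'rV[R]_2 * R),
       generic_set J /\
       forall (V : set 'rV[R]_3) (f : 'rV[R]_3 -> R),
         open V -> V (s y) -> V `<=` W -> solution V E f ->
         J (Cauchy_jet s nu f y) ->
         exists U : set 'rV[R]_3,
           [/\ open U, U (s y), U `<=` V & nondegenerate_sol U E f]) /\
  (forall (U : set 'rV[R]_3) (f : 'rV[R]_3 -> R),
     open U -> U `<=` W -> solution U E f -> nondegenerate_sol U E f ->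
     Veronese_web U (web_distribution E f)).
Proof.
split=> [Y s nu y CS Yy _|U f oU UW sol nd].
  exact: generic_nondegenerate E_adm CS Yy.
exact: solution_Veronese_web E_adm oU UW sol nd.
Qed.
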